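(* Let $\lambda(u,v)$, $\mu(u,v)$, $\nu(u,v)$ be smooth real functions defined in a domain $\mathcal{D}\subset\mathbb{R}^2$ and satisfying $$\begin{array}{l} \mu \neq 0 \text{ everywhere}, \quad \nu \neq \mathrm{const};\\ \nu_u = \lambda_v - \lambda\,(\ln|\mu|)_v;\\ \nu_v = \lambda_u - \lambda\,(\ln|\mu|)_u;\\ \nu^2 - (\lambda^2+\mu^2) = \tfrac12\,|\mu|\,\Delta\ln|\mu|, \end{array}$$ where $\Delta = \frac{\partial^2}{\partial u^2}+\frac{\partial^2}{\partial v^2}$. Let $(u_0,v_0)\in\mathcal{D}$ with $\nu(u_0,v_0)\neq 0$, and let $\{x_0,y_0,b_0,l_0\}$ be an orthonormal frame at a point $p_0\in\mathbb{E}^4$. Then there exist a subdomain $\mathcal{D}_0\subset\mathcal{D}$ containing $(u_0,v_0)$ and a unique surface $M^2: z = z(u,v)$, $(u,v)\in\mathcal{D}_0$, in $\mathbb{E}^4$ with parallel normalized mean curvature vector field, such that: $z(u_0,v_0) = p_0$; $\{x_0,y_0,b_0,l_0\}$ is the geometric frame of $M^2$ at $p_0$; the functions $\lambda(u,v),\mu(u,v),\nu(u,v)$ are the geometric functions of $M^2$; and $(u,v)$ are canonical parameters of $M^2$.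
   Context: Let $M^2$ be a smooth 2-dimensional surface in Euclidean 4-space $\mathbb{E}^4$ with flat connection $\nabla'$, second fundamental form $\sigma$ and normal connection $D$. The mean curvature vector field is $H = \frac12\operatorname{tr}\sigma$. $M^2$ has parallel normalized mean curvature vector field if $H$ is nowhere zero and there is a unit normal vector field $b$ in the direction of $H$ (collinear with $H$) with $Db=0$ identically. Geometric frame and functions: a geometric frame field of a surface with $H\ne0$ is an orthonormal frame field $\{x,y,b,l\}$ with $x,y$ tangent, $b,l$ normal, $b$ collinear with $H$, and $$\sigma(x,x) = \nu_1 b,\qquad \sigma(x,y)=\lambda b+\mu l,\qquad \sigma(y,y)=\nu_2 b .$$ The functions $\nu_1,\nu_2,\lambda,\mu$ so defined are geometric functions of the surface. For surfaces with parallel normalized mean curvature vector field and $\mu\neq0$ one has $\nu_1=\nu_2$, and this common function is denoted $\nu$ (so $H=\nu b$); ''the geometric functions'' $\lambda,\mu,\nu$ of such a surface are these functions. For a parametrization $z(u,v)$, $E=\langle z_u,z_u\rangle$, $F=\langle z_u,z_v\rangle$, $G=\langle z_v,z_v\rangle$. The parameters $(u,v)$ are canonical if $E=G=1/|\mu|$ and $F=0$. The geometric frame of a surface parametrized by $(u,v)$ is understood to be adapted to the parameters: $x = z_u/\sqrt{E}$, $y = z_v/\sqrt{G}$. A domain is a nonempty connected open set. *)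

(* Defs.v *)
From Stdlib Require Import Reals.
From Coquelicot Require Import Coquelicot.
Open Scope R_scope.

Definition connected_set (D : R * R -> Prop) : Prop :=
  forall A B : R * R -> Prop, open A -> open B ->
    (forall p, D p -> A p \/ B p) ->
    (exists p, D p /\ A p) -> (exists p, D p /\ B p) ->
    exists p, D p /\ A p /\ B p.

Definition planar_domain (D : R * R -> Prop) : Prop :=
  (exists p, D p) /\ open D /\ connected_set D.

Definition du (f : R -> R -> R) : R -> R -> R :=
  fun u v => Derive (fun t => f t v) u.

Definition dv (f : R -> R -> R) : R -> R -> R :=
  fun u v => Derive (fun t => f u t) v.

Definition laplacian (f : R -> R -> R) : R -> R -> R :=
  fun u v => du (du f) u v + dv (dv f) u v.

(* [ex_diff_n f n u v] says that all iterated partial derivatives of order at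
   most [n] exist and are continuous at [(u, v)]; on an open set [D] this is
   therefore the usual notion of a C^infinity function. *)
Definition smooth (D : R * R -> Prop) (f : R -> R -> R) : Prop :=
  forall u v, D (u, v) -> forall n, ex_diff_n f n u v.

(* Vector operations on [E4] are Coquelicot's [plus], [minus], [scal], [zero]
   on iterated products of normed modules. *)
Definition E4 : Type := (R * R * R * R)%type.

Definition c1 (p : E4) : R := fst (fst (fst p)).
Definition c2 (p : E4) : R := snd (fst (fst p)).
Definition c3 (p : E4) : R := snd (fst p).
Definition c4 (p : E4) : R := snd p.

Definition dot (p q : E4) : R :=
  c1 p * c1 q + c2 p * c2 q + c3 p * c3 q + c4 p * c4 q.

Definition orthonormal (x y b l : E4) : Prop :=
  (dot x x = 1 /\ dot y y = 1 /\ dot b b = 1 /\ dot l l = 1) /\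
  (dot x y = 0 /\ dot x b = 0 /\ dot x l = 0 /\
   dot y b = 0 /\ dot y l = 0 /\ dot b l = 0).

Definition smoothE (D : R * R -> Prop) (w : R -> R -> E4) : Prop :=
  smooth D (fun u v => c1 (w u v)) /\ smooth D (fun u v => c2 (w u v)) /\
  smooth D (fun u v => c3 (w u v)) /\ smooth D (fun u v => c4 (w u v)).

Definition duE (w : R -> R -> E4) : R -> R -> E4 := fun u v =>
  (du (fun s t => c1 (w s t)) u v, du (fun s t => c2 (w s t)) u v,
   du (fun s t => c3 (w s t)) u v, du (fun s t => c4 (w s t)) u v).

Definition dvE (w : R -> R -> E4) : R -> R -> E4 := fun u v =>
  (dv (fun s t => c1 (w s t)) u v, dv (fun s t => c2 (w s t)) u v,
   dv (fun s t => c3 (w s t)) u v, dv (fun s t => c4 (w s t)) u v).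

Definition regular_surface (D : R * R -> Prop) (z : R -> R -> E4) : Prop :=
  smoothE D z /\
  forall u v, D (u, v) -> forall a b : R,
    plus (scal a (duE z u v)) (scal b (dvE z u v)) = zero ->
    a = 0 /\ b = 0.

Definition ffE (z : R -> R -> E4) u v : R := dot (duE z u v) (duE z u v).
Definition ffF (z : R -> R -> E4) u v : R := dot (duE z u v) (dvE z u v).
Definition ffG (z : R -> R -> E4) u v : R := dot (dvE z u v) (dvE z u v).

(* A tangent vector field is given by its coefficients with respect to the
   coordinate basis [z_u, z_v]. *)
Definition tfield : Type := R -> R -> R * R.

Definition coord_u : tfield := fun _ _ => (1, 0).
Definition coord_v : tfield := fun _ _ => (0, 1).

Definition push (z : R -> R -> E4) (X : tfield) : R -> R -> E4 := fun u v =>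
  plus (scal (fst (X u v)) (duE z u v)) (scal (snd (X u v)) (dvE z u v)).

(* The flat connection of E^4: derivative along [X] of a vector field [w]
   defined along the surface. *)
Definition flat (X : tfield) (w : R -> R -> E4) : R -> R -> E4 := fun u v =>
  plus (scal (fst (X u v)) (duE w u v)) (scal (snd (X u v)) (dvE w u v)).

(* Orthogonal projections onto the span of [z_u, z_v] (the inverse Gram matrix
   applied to the two scalar products) and onto its orthogonal complement. *)
Definition tangential (z : R -> R -> E4) u v (w : E4) : E4 :=
  let E := ffE z u v in let F := ffF z u v in let G := ffG z u v in
  let p := dot w (duE z u v) in let q := dot w (dvE z u v) in
  plus (scal ((G * p - F * q) / (E * G - F ^ 2)) (duE z u v))
       (scal ((E * q - F * p) / (E * G - F ^ 2)) (dvE z u v)).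

Definition normal (z : R -> R -> E4) u v (w : E4) : E4 :=
  minus w (tangential z u v w).

(* Gauss formula: sigma(X, Y) is the normal part of nabla'_X Y. *)
Definition sff (z : R -> R -> E4) (X Y : tfield) : R -> R -> E4 := fun u v =>
  normal z u v (flat X (push z Y) u v).

(* Weingarten formula: D_X xi is the normal part of nabla'_X xi. *)
Definition normal_connection (z : R -> R -> E4) (X : tfield)
    (xi : R -> R -> E4) : R -> R -> E4 := fun u v =>
  normal z u v (flat X xi u v).

(* H = (1/2) tr sigma, the trace being taken with respect to the metric
   E du^2 + 2 F du dv + G dv^2. *)
Definition mean_curvature (z : R -> R -> E4) : R -> R -> E4 := fun u v =>
  let E := ffE z u v in let F := ffF z u v in let G := ffG z u v in
  scal (/ 2 * / (E * G - F ^ 2))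
    (plus (minus (scal G (sff z coord_u coord_u u v))
                 (scal (2 * F) (sff z coord_u coord_v u v)))
          (scal E (sff z coord_v coord_v u v))).

Definition collinear (b H : E4) : Prop := exists c : R, H = scal c b.

Definition parallel_normalized_mean_curvature
    (D : R * R -> Prop) (z : R -> R -> E4) : Prop :=
  (forall u v, D (u, v) -> mean_curvature z u v <> zero) /\
  exists b : R -> R -> E4,
    smoothE D b /\
    forall u v, D (u, v) ->
      (dot (b u v) (b u v) = 1 /\
       dot (b u v) (duE z u v) = 0 /\ dot (b u v) (dvE z u v) = 0) /\
      collinear (b u v) (mean_curvature z u v) /\
      forall X : tfield, normal_connection z X b u v = zero.

(* The tangent part of the frame adapted to the parameters:
   x = z_u / sqrt E and y = z_v / sqrt G. *)
Definition frame_x (z : R -> R -> E4) : tfield :=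
  fun u v => (/ sqrt (ffE z u v), 0).
Definition frame_y (z : R -> R -> E4) : tfield :=
  fun u v => (0, / sqrt (ffG z u v)).

(* [x, y, b, l], with [x, y] adapted to the parameters, is a geometric frame
   field on [D], and [nu1, nu2, lam, mu] are the corresponding geometric
   functions. *)
Definition geometric_frame (D : R * R -> Prop) (z b l : R -> R -> E4)
    (nu1 nu2 lam mu : R -> R -> R) : Prop :=
  smoothE D b /\ smoothE D l /\
  forall u v, D (u, v) ->
    let x := frame_x z in let y := frame_y z in
    orthonormal (push z x u v) (push z y u v) (b u v) (l u v) /\
    collinear (b u v) (mean_curvature z u v) /\
    sff z x x u v = scal (nu1 u v) (b u v) /\
    sff z x y u v = plus (scal (lam u v) (b u v)) (scal (mu u v) (l u v)) /\
    sff z y y u v = scal (nu2 u v) (b u v).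

Definition canonical_parameters (D : R * R -> Prop) (z : R -> R -> E4)
    (mu : R -> R -> R) : Prop :=
  forall u v, D (u, v) ->
    ffE z u v = 1 / Rabs (mu u v) /\ ffG z u v = 1 / Rabs (mu u v) /\
    ffF z u v = 0.

Definition ln_abs (f : R -> R -> R) : R -> R -> R :=
  fun u v => ln (Rabs (f u v)).

(* The conditions on a parametrized surface [z] over [D] with prescribed
   geometric functions (where [nu1 = nu2 = nu]) and prescribed geometric frame
   [x0, y0, b0, l0] at the point [p0 = z u0 v0]. *)
Definition prescribed_surface (D : R * R -> Prop) (lam mu nu : R -> R -> R)
    (u0 v0 : R) (p0 x0 y0 b0 l0 : E4) (z : R -> R -> E4) : Prop :=
  regular_surface D z /\
  parallel_normalized_mean_curvature D z /\
  z u0 v0 = p0 /\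
  (exists b l : R -> R -> E4,
    geometric_frame D z b l nu nu lam mu /\
    push z (frame_x z) u0 v0 = x0 /\ push z (frame_y z) u0 v0 = y0 /\
    b u0 v0 = b0 /\ l u0 v0 = l0) /\
  canonical_parameters D z mu.

(* Main.v *)
Require Import Defs.
From Stdlib Require Import Reals Lra Lia Classical.
From Coquelicot Require Import Coquelicot.
Import Defs.
Open Scope R_scope.

(** The theorem is a Bonnet theorem. Write [w = ln |mu|], [phi = exp (- w / 2)],
    so that canonical parameters mean [z_u = phi x], [z_v = phi y] with [x], [y]
    orthonormal, and put [p = w_u / 2], [q = w_v / 2], [al = phi nu],
    [be = phi lam], [ga = phi mu]. A surface as required, together with its
    geometric frame, is the same thing as an orthonormal solution of

      x_u = q y + al b             x_v = - p y + be b + ga l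
      y_u = - q x + be b + ga l    y_v = p x + al b
      b_u = - al x - be y          b_v = - be x - al y
      l_u = - ga y                 l_v = - ga x
      z_u = phi x                  z_v = phi y,

    a linear Pfaffian system [Y_u = A Y], [Y_v = B Y] solved by each of the four
    coordinates of [(x, y, b, l, z)] separately. Its integrability condition
    [A_v + A B = B_u + B A] is what the three differential equations imposed on
    [lam], [mu], [nu] express ([frame_mx_integrable]), so existence and
    uniqueness both follow from Frobenius' theorem for linear systems
    ([pfaff_solvable]).

    From the system to the surface ([frame_equations_surface]): the frame stays
    orthonormal because the derivation matrices are skew
    ([frame_stays_orthonormal]); then the second fundamental form, [H = nu b] and
    [Db = 0] are read off. The square on which the system is solved is taken
    inside [nu <> 0], which makes [H] nowhere zero.

    From the surface to the system ([given_frame_equations]): an orthonormal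
    frame has skew derivatives, so they are determined by six scalar products
    in each direction. Those come from the second fundamental form, from
    [z_uv = z_vu], and from [Db = 0], where the parallel unit normal agrees with
    [b] up to a locally constant sign.

    Frobenius' theorem itself is proved on a small square, where the
    coefficients have total mass at most [1/2] on each half-side: Picard iteration
    gives solutions of linear ordinary systems, a Gronwall-type estimate
    ([short_time_estimate]) gives uniqueness, and the same estimate applied to
    difference quotients ([transverse_derivative]) shows that the solution built
    along [v = v0] and then along the lines [u = const] also satisfies the
    equation in the direction of [u]. Smoothness is bootstrapped from the
    equations. *)

(** * Calculus of real functions of one variable *)

Lemma is_derive_value (f : R -> R) (t l m : R) :
  is_derive f t l -> l = m -> is_derive f t m.
Proof. now intros H <-. Qed.

Lemma is_derive_Rplus (f g : R -> R) (t l m : R) :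
  is_derive f t l -> is_derive g t m -> is_derive (fun s => f s + g s) t (l + m).
Proof. intros; now apply (is_derive_plus f g). Qed.

Lemma is_derive_Rminus (f g : R -> R) (t l m : R) :
  is_derive f t l -> is_derive g t m -> is_derive (fun s => f s - g s) t (l - m).
Proof. intros; now apply (is_derive_minus f g). Qed.

(** * Row by column products *)

Definition row_col (N : nat) (a y : nat -> R) : R :=
  sum_f_R0 (fun j => a j * y j) N.

Lemma row_col_ext N a a' y y' :
  (forall j, (j <= N)%nat -> a j = a' j) ->
  (forall j, (j <= N)%nat -> y j = y' j) ->
  row_col N a y = row_col N a' y'.
Proof.
  intros Ha Hy; apply sum_eq; intros j Hj; rewrite Ha, Hy; auto.
Qed.

Lemma row_col_minus_r N a y y' :
  row_col N a (fun j => y j - y' j) = row_col N a y - row_col N a y'.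
Proof.
  unfold row_col; rewrite <- minus_sum; apply sum_eq; intros; ring.
Qed.

Lemma row_col_scal_r N a k y :
  row_col N a (fun j => k * y j) = k * row_col N a y.
Proof.
  unfold row_col; rewrite scal_sum; apply sum_eq; intros; ring.
Qed.

Lemma row_col_plus_l N a a' y :
  row_col N (fun j => a j + a' j) y = row_col N a y + row_col N a' y.
Proof.
  unfold row_col; rewrite <- plus_sum; apply sum_eq; intros; ring.
Qed.

Lemma row_col_minus_l N a a' y :
  row_col N (fun j => a j - a' j) y = row_col N a y - row_col N a' y.
Proof.
  unfold row_col; rewrite <- minus_sum; apply sum_eq; intros; ring.
Qed.

Lemma row_col_scal_l N k a y :
  row_col N (fun j => k * a j) y = k * row_col N a y.
Proof.
  unfold row_col; rewrite scal_sum; apply sum_eq; intros; ring.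
Qed.

Lemma row_col_assoc N a (B : nat -> nat -> R) y :
  row_col N a (fun i => row_col N (B i) y)
  = row_col N (fun j => row_col N a (fun i => B i j)) y.
Proof.
  assert (G : forall M, row_col M a (fun i => row_col N (B i) y)
      = row_col N (fun j => row_col M a (fun i => B i j)) y).
  { induction M as [|M IH].
    - unfold row_col; simpl; rewrite scal_sum; apply sum_eq; intros; ring.
    - change (row_col M a (fun i => row_col N (B i) y)
              + a (S M) * row_col N (B (S M)) y
        = row_col N (fun j => row_col M a (fun i => B i j)
                              + a (S M) * B (S M) j) y).
      rewrite row_col_plus_l, row_col_scal_l, IH; reflexivity. }
  apply G.
Qed.

Lemma row_col_bound N a y C M :
  0 <= C ->
  (forall j, (j <= N)%nat -> Rabs (a j) <= C) ->
  (forall j, (j <= N)%nat -> Rabs (y j) <= M) ->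
  Rabs (row_col N a y) <= INR (S N) * C * M.
Proof.
  intros HC Ha Hy; unfold row_col.
  eapply Rle_trans; [apply Rsum_abs|].
  replace (INR (S N) * C * M) with (sum_f_R0 (fun _ => C * M) N).
  - apply sum_Rle; intros j Hj; rewrite Rabs_mult.
    apply Rmult_le_compat; auto using Rabs_pos.
  - rewrite sum_cte; ring.
Qed.

Lemma is_derive_row_col N (a : nat -> R -> R) (y : nat -> R -> R)
    (a' y' : nat -> R) (t : R) :
  (forall j, (j <= N)%nat -> is_derive (a j) t (a' j)) ->
  (forall j, (j <= N)%nat -> is_derive (y j) t (y' j)) ->
  is_derive (fun s => row_col N (fun j => a j s) (fun j => y j s)) t
    (row_col N a' (fun j => y j t) + row_col N (fun j => a j t) y').
Proof.
  intros Ha Hy; unfold row_col; rewrite <- plus_sum.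
  assert (G : forall M, (M <= N)%nat ->
    is_derive (fun s => sum_f_R0 (fun j => a j s * y j s) M) t
      (sum_f_R0 (fun j => a' j * y j t + a j t * y' j) M)).
  { induction M as [|M IH]; intros HM; simpl.
    - apply Derive.is_derive_mult; auto.
    - apply is_derive_Rplus; [apply IH; lia|].
      apply Derive.is_derive_mult; auto. }
  apply G; lia.
Qed.

Lemma continuous_row_col N (a y : nat -> R -> R) (t : R) :
  (forall j, (j <= N)%nat -> continuous (a j) t) ->
  (forall j, (j <= N)%nat -> continuous (y j) t) ->
  continuous (fun s => row_col N (fun j => a j s) (fun j => y j s)) t.
Proof.
  intros Ha Hy; unfold row_col.
  assert (G : forall M, (M <= N)%nat ->
    continuous (fun s => sum_f_R0 (fun j => a j s * y j s) M) t).
  { induction M as [|M IH]; intros HM; simpl.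
    - apply (continuous_mult (a _) (y _)); auto.
    - apply (continuous_plus (fun s => sum_f_R0 (fun j => a j s * y j s) M)
               (fun s => a (S M) s * y (S M) s)); [apply IH; lia|].
      apply (continuous_mult (a _) (y _)); auto. }
  apply G; lia.
Qed.

Lemma is_lim_seq_row_col N (a : nat -> R) (y : nat -> nat -> R) (l : nat -> R) :
  (forall j, (j <= N)%nat -> is_lim_seq (fun n => y n j) (l j)) ->
  is_lim_seq (fun n => row_col N a (y n)) (row_col N a l).
Proof.
  intros Hy; unfold row_col.
  assert (G : forall M, (M <= N)%nat ->
    is_lim_seq (fun n => sum_f_R0 (fun j => a j * y n j) M)
      (sum_f_R0 (fun j => a j * l j) M)).
  { induction M as [|M IH]; intros HM; simpl.
    - apply (is_lim_seq_scal_l _ (a 0%nat) (l 0%nat)); auto.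
    - apply is_lim_seq_plus'; [apply IH; lia|].
      apply (is_lim_seq_scal_l _ (a (S M)) (l (S M))); auto. }
  apply G; lia.
Qed.

(** * Linear differential systems on a short interval *)

(** Over an interval on which the coefficients have total mass at most [1/2],
    the fundamental theorem halves any a priori bound, so a crude bound can be
    iterated away and only the data remain. *)
Lemma short_time_estimate N (B : nat -> nat -> R -> R) (W e : nat -> R -> R)
    (a d C eps eta : R) :
  0 <= d -> 0 <= C -> INR (S N) * C * d <= / 2 ->
  (forall i j t, (i <= N)%nat -> (j <= N)%nat -> Rabs (t - a) <= d ->
     Rabs (B i j t) <= C) ->
  (forall i t, (i <= N)%nat -> Rabs (t - a) <= d -> Rabs (e i t) <= eps) ->
  (forall i, (i <= N)%nat -> Rabs (W i a) <= eta) ->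
  (forall i t, (i <= N)%nat -> Rabs (t - a) <= d ->
     is_derive (W i) t (row_col N (fun j => B i j t) (fun j => W j t) + e i t)) ->
  forall i t, (i <= N)%nat -> Rabs (t - a) <= d ->
    Rabs (W i t) <= 2 * (eta + d * eps).
Proof.
  intros Hd HC Hs HB He Ha HW.
  assert (Heps : 0 <= eps).
  { eapply Rle_trans; [apply Rabs_pos|apply (He 0%nat a); [lia|]].
    rewrite Rminus_diag, Rabs_R0; exact Hd. }
  assert (Heta : 0 <= eta).
  { eapply Rle_trans; [apply Rabs_pos|apply (Ha 0%nat); lia]. }
  assert (Hbd : forall n, (n <= N)%nat -> exists M, 0 <= M /\
    forall i t, (i <= n)%nat -> Rabs (t - a) <= d -> Rabs (W i t) <= M).
  { assert (One : forall i, (i <= N)%nat -> exists M, 0 <= M /\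
      forall t, Rabs (t - a) <= d -> Rabs (W i t) <= M).
    { intros i Hi.
      destruct (continuity_ab_maj (fun t => Rabs (W i t)) (a - d) (a + d))
        as [m [Hm _]]; [lra| |].
      - intros t Ht; apply continuity_pt_filterlim.
        apply (continuous_comp (W i) Rabs); [|apply continuous_Rabs].
        apply (ex_derive_continuous (W i)); eexists; apply HW; auto.
        apply Rabs_le; lra.
      - exists (Rabs (W i m)); split; [apply Rabs_pos|].
        intros t Ht; apply Hm; apply Rabs_le_between in Ht; lra. }
    induction n as [|n IH]; intros Hn.
    - destruct (One 0%nat Hn) as [M [M0 HM]]; exists M; split; auto.
      intros i t Hi; replace i with 0%nat by lia; auto.
    - destruct IH as [M1 [M10 HM1]]; [lia|].
      destruct (One (S n) Hn) as [M2 [M20 HM2]].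
      exists (M1 + M2); split; [lra|]; intros i t Hi Ht.
      destruct (Nat.eq_dec i (S n)) as [->|Hne].
      + specialize (HM2 t Ht); lra.
      + assert (Hi' : (i <= n)%nat) by lia.
        specialize (HM1 i t Hi' Ht); lra. }
  destruct (Hbd N (Nat.le_refl N)) as [M [M0 HM]].
  assert (Halve : forall K, 0 <= K ->
    (forall i t, (i <= N)%nat -> Rabs (t - a) <= d -> Rabs (W i t) <= K) ->
    forall i t, (i <= N)%nat -> Rabs (t - a) <= d ->
      Rabs (W i t) <= eta + d * eps + K / 2).
  { intros K K0 HK i t Hi Ht.
    assert (V : Rabs (W i t - W i a) <= (INR (S N) * C * K + eps) * Rabs (t - a)).
    { apply (bounded_variation (W i)
        (fun t => row_col N (fun j => B i j t) (fun j => W j t) + e i t)).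
      intros s Hs'; assert (Hsd : Rabs (s - a) <= d) by lra.
      split; [auto|].
      eapply Rle_trans; [apply Rabs_triang|].
      apply Rplus_le_compat; auto.
      apply row_col_bound; auto. }
    assert (V2 : (INR (S N) * C * K + eps) * Rabs (t - a)
                 <= (INR (S N) * C * K + eps) * d).
    { apply Rmult_le_compat_l; auto.
      assert (0 <= INR (S N) * C * K); [|lra].
      repeat apply Rmult_le_pos; auto; apply pos_INR. }
    assert (V3 : INR (S N) * C * d * K <= / 2 * K)
      by (apply Rmult_le_compat_r; auto).
    specialize (Ha i Hi).
    assert (V4 : Rabs (W i t) <= Rabs (W i t - W i a) + Rabs (W i a)).
    { replace (W i t) with ((W i t - W i a) + W i a) at 1 by ring.
      apply Rabs_triang. }
    nra. }
  assert (Hde : 0 <= d * eps) by (apply Rmult_le_pos; auto).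
  assert (It : forall n i t, (i <= N)%nat -> Rabs (t - a) <= d ->
    Rabs (W i t) <= 2 * (eta + d * eps) + M * (/ 2) ^ n).
  { induction n as [|n IH]; intros i t Hi Ht.
    - simpl; specialize (HM i t Hi Ht); lra.
    - assert (0 <= (/ 2) ^ n) by (apply pow_le; lra).
      assert (0 <= M * (/ 2) ^ n) by (apply Rmult_le_pos; auto).
      eapply Rle_trans; [apply (Halve (2 * (eta + d * eps) + M * (/ 2) ^ n)); auto|].
      + lra.
      + simpl; lra. }
  intros i t Hi Ht.
  assert (L : Rbar_le (Rabs (W i t)) (2 * (eta + d * eps) + M * 0)).
  { eapply is_lim_seq_le; [intros n; apply (It n i t Hi Ht) | apply is_lim_seq_const|].
    apply is_lim_seq_plus'; [apply is_lim_seq_const|].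
    apply (is_lim_seq_scal_l _ M 0).
    apply is_lim_seq_geom; rewrite Rabs_right; lra. }
  simpl in L; lra.
Qed.

(** The difference of two solutions satisfies the estimate without data. *)
Lemma short_time_unique N (B : nat -> nat -> R -> R) (Y Z : nat -> R -> R)
    (a d C : R) :
  0 <= C -> INR (S N) * C * d <= / 2 ->
  (forall i j t, (i <= N)%nat -> (j <= N)%nat -> Rabs (t - a) < d ->
     Rabs (B i j t) <= C) ->
  (forall i, (i <= N)%nat -> Y i a = Z i a) ->
  (forall i t, (i <= N)%nat -> Rabs (t - a) < d ->
     is_derive (Y i) t (row_col N (fun j => B i j t) (fun j => Y j t))) ->
  (forall i t, (i <= N)%nat -> Rabs (t - a) < d ->
     is_derive (Z i) t (row_col N (fun j => B i j t) (fun j => Z j t))) ->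
  forall i t, (i <= N)%nat -> Rabs (t - a) < d -> Y i t = Z i t.
Proof.
  intros HC Hs HB Ha HY HZ i t Hi Ht.
  assert (E : Rabs (Y i t - Z i t) <= 2 * (0 + Rabs (t - a) * 0)).
  { apply (short_time_estimate N B (fun i t => Y i t - Z i t) (fun _ _ => 0)
             a (Rabs (t - a)) C 0 0); auto using Rabs_pos; try lra.
    - eapply Rle_trans; [|apply Hs]; apply Rmult_le_compat_l; [|lra].
      apply Rmult_le_pos; auto; apply pos_INR.
    - intros; apply HB; auto; lra.
    - intros; rewrite Rabs_R0; lra.
    - intros j Hj; rewrite (Ha j Hj), Rminus_diag, Rabs_R0; lra.
    - intros j s Hj Hs'.
      rewrite row_col_minus_r, Rplus_0_r.
      apply is_derive_Rminus; [apply HY|apply HZ]; auto; lra. }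
  assert (Rabs (Y i t - Z i t) = 0)
    by (apply Rle_antisym; [lra|apply Rabs_pos]).
  destruct (Req_dec (Y i t - Z i t) 0) as [?|Hn]; [lra|].
  apply Rabs_no_R0 in Hn; lra.
Qed.

(** Stated on an open interval, where the coefficients of the system are
    controlled. *)
Lemma is_derive_primitive (f : R -> R) (a d t : R) :
  (forall s, Rabs (s - a) < d -> continuous f s) ->
  Rabs (t - a) < d -> is_derive (fun t => RInt f a t) t (f t).
Proof.
  intros Hf Ht.
  apply (is_derive_RInt f (fun t => RInt f a t) a t); [|auto].
  assert (Hr : 0 < d - Rabs (t - a)) by lra.
  exists (mkposreal _ Hr); intros s Hs.
  change (Rabs (s - t) < d - Rabs (t - a)) in Hs.
  apply (RInt_correct f), (ex_RInt_continuous f); intros r Hr'; apply Hf.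
  assert (Rabs (s - a) <= Rabs (s - t) + Rabs (t - a)).
  { replace (s - a) with ((s - t) + (t - a)) by ring; apply Rabs_triang. }
  apply Rle_lt_trans with (Rabs (s - a)); [|lra].
  unfold Rmin, Rmax in Hr'; destruct (Rle_dec a s);
    unfold Rabs; destruct (Rcase_abs (r - a)), (Rcase_abs (s - a)); lra.
Qed.

Lemma geometric_small (K eps : R) : 0 < eps -> exists n : nat, K * (/ 2) ^ n < eps.
Proof.
  intros He.
  assert (L : is_lim_seq (fun n => K * (/ 2) ^ n) 0).
  { replace (Finite 0) with (Rbar_mult K 0) by (simpl; f_equal; ring).
    apply (is_lim_seq_scal_l _ K 0), is_lim_seq_geom; rewrite Rabs_right; lra. }
  apply is_lim_seq_spec in L; destruct (L (mkposreal _ He)) as [n Hn].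
  exists n; specialize (Hn n (Nat.le_refl n)); simpl in Hn.
  rewrite Rminus_0_r in Hn; apply Rabs_def2 in Hn; lra.
Qed.

Fixpoint picard (N : nat) (B : nat -> nat -> R -> R) (a : R) (c : nat -> R)
    (n i : nat) (t : R) : R :=
  match n with
  | O => c i
  | S m => c i + RInt (fun s => row_col N (fun j => B i j s)
                                  (fun j => picard N B a c m j s)) a t
  end.

Definition picard_limit N B a c (i : nat) (t : R) : R :=
  Lim_seq (fun n => picard N B a c n i t).

Section Picard.
Variables (N : nat) (B : nat -> nat -> R -> R) (a d C M : R) (c : nat -> R).
Hypothesis HC : 0 <= C.
Hypothesis Hs : INR (S N) * C * d <= / 2.
Hypothesis HB : forall i j t, (i <= N)%nat -> (j <= N)%nat -> Rabs (t - a) < d ->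
  continuous (B i j) t /\ Rabs (B i j t) <= C.
Hypothesis Hc : forall i, (i <= N)%nat -> Rabs (c i) <= M.

Let Y := picard N B a c.
Let rhs n i t := row_col N (fun j => B i j t) (fun j => Y n j t).

Lemma picard_initial n i : Y n i a = c i.
Proof.
  destruct n; simpl; auto.
  unfold Y; simpl; rewrite RInt_point; apply Rplus_0_r.
Qed.

Lemma picard_continuous n i t :
  (i <= N)%nat -> Rabs (t - a) < d -> continuous (Y n i) t.
Proof.
  revert i t; induction n as [|n IH]; intros i t Hi Ht.
  - apply continuous_const.
  - apply (continuous_plus (fun _ => c i)
      (fun t => RInt (rhs n i) a t)); [apply continuous_const|].
    apply (ex_derive_continuous (fun t => RInt (rhs n i) a t)).
    eexists; apply (is_derive_primitive _ a d); auto.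
    intros s Hs'; apply continuous_row_col; intros j Hj; [apply HB|apply IH]; auto.
Qed.

Lemma picard_rhs_continuous n i t :
  (i <= N)%nat -> Rabs (t - a) < d -> continuous (rhs n i) t.
Proof.
  intros Hi Ht; apply continuous_row_col; intros j Hj;
    [apply HB | apply picard_continuous]; auto.
Qed.

Lemma picard_derive n i t :
  (i <= N)%nat -> Rabs (t - a) < d -> is_derive (Y (S n) i) t (rhs n i t).
Proof.
  intros Hi Ht.
  replace (rhs n i t) with (0 + rhs n i t) by ring.
  apply (is_derive_Rplus (fun _ => c i) (fun t => RInt (rhs n i) a t)).
  - apply (is_derive_const (c i)).
  - apply (is_derive_primitive _ a d); auto.
    intros; apply picard_rhs_continuous; auto.
Qed.

(** Integration over a short interval halves a bound, so the increments of the
    iterates decrease geometrically. *)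
Lemma picard_step n i t : (i <= N)%nat -> Rabs (t - a) < d ->
  Rabs (Y (S n) i t - Y n i t) <= M * (/ 2) ^ S n.
Proof.
  assert (M0 : 0 <= M)
    by (eapply Rle_trans; [apply Rabs_pos|apply (Hc 0%nat); lia]).
  (* One integration costs the factor [INR (S N) * C * d <= 1/2]. *)
  assert (Gen : forall h dh K, h a = 0 -> 0 <= K ->
    (forall s, Rabs (s - a) < d ->
       is_derive h s (dh s) /\ Rabs (dh s) <= INR (S N) * C * K) ->
    forall t, Rabs (t - a) < d -> Rabs (h t) <= / 2 * K).
  { intros h dh K Hh HK Hd s Hs'.
    replace (h s) with (h s - h a) by (rewrite Hh; ring).
    eapply Rle_trans.
    - apply (bounded_variation h dh (INR (S N) * C * K)).
      intros r Hr; apply Hd; lra.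
    - assert (INR (S N) * C * d * K <= / 2 * K) by (apply Rmult_le_compat_r; auto).
      assert (0 <= INR (S N) * C * K)
        by (repeat apply Rmult_le_pos; auto; apply pos_INR).
      assert (INR (S N) * C * K * Rabs (s - a) <= INR (S N) * C * K * d)
        by (apply Rmult_le_compat_l; lra).
      lra. }
  revert i t; induction n as [|n IH]; intros i t Hi Ht.
  - replace (M * (/ 2) ^ 1) with (/ 2 * M) by (simpl; ring).
    apply (Gen (fun t => Y 1 i t - Y 0 i t) (fun t => rhs 0 i t - 0)); auto.
    + rewrite !picard_initial; ring.
    + intros s Hs'; split.
      * apply is_derive_Rminus; [apply picard_derive; auto|].
        apply (is_derive_const (c i)).
      * rewrite Rminus_0_r; apply row_col_bound; auto.
        intros j Hj; apply HB; auto.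
  - replace (M * (/ 2) ^ S (S n)) with (/ 2 * (M * (/ 2) ^ S n)) by (simpl; ring).
    apply (Gen (fun t => Y (S (S n)) i t - Y (S n) i t)
               (fun t => rhs (S n) i t - rhs n i t)); auto.
    + rewrite !picard_initial; ring.
    + apply Rmult_le_pos; auto; apply pow_le; lra.
    + intros s Hs'; split.
      * apply is_derive_Rminus; apply picard_derive; auto.
      * unfold rhs; rewrite <- row_col_minus_r; apply row_col_bound; auto.
        intros j Hj; apply HB; auto.
Qed.

Lemma picard_tail n k i t : (i <= N)%nat -> Rabs (t - a) < d ->
  Rabs (Y (n + k) i t - Y n i t) <= M * (/ 2) ^ n.
Proof.
  intros Hi Ht.
  assert (M0 : 0 <= M)
    by (eapply Rle_trans; [apply Rabs_pos|apply (Hc 0%nat); lia]).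
  assert (P : forall m, 0 <= M * (/ 2) ^ m)
    by (intros; apply Rmult_le_pos; auto; apply pow_le; lra).
  assert (G : Rabs (Y (n + k) i t - Y n i t)
              <= M * (/ 2) ^ n - M * (/ 2) ^ (n + k)).
  { induction k as [|k IH].
    - rewrite Nat.add_0_r, Rminus_diag, Rabs_R0; lra.
    - rewrite Nat.add_succ_r.
      pose proof (picard_step (n + k) i t Hi Ht) as S1.
      replace (Y (S (n + k)) i t - Y n i t) with
        ((Y (S (n + k)) i t - Y (n + k) i t) + (Y (n + k) i t - Y n i t)) by ring.
      eapply Rle_trans; [apply Rabs_triang|]; simpl in S1 |- *; lra. }
  specialize (P (n + k)%nat); lra.
Qed.

Lemma picard_pair p q n i t : (n <= p)%nat -> (n <= q)%nat ->
  (i <= N)%nat -> Rabs (t - a) < d ->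
  Rabs (Y p i t - Y q i t) <= 2 * M * (/ 2) ^ n.
Proof.
  intros Hp Hq Hi Ht.
  replace p with (n + (p - n))%nat by lia; replace q with (n + (q - n))%nat by lia.
  pose proof (picard_tail n (p - n) i t Hi Ht) as E1.
  pose proof (picard_tail n (q - n) i t Hi Ht) as E2.
  rewrite Rabs_minus_sym in E2.
  replace (Y (n + (p - n)) i t - Y (n + (q - n)) i t) with
    ((Y (n + (p - n)) i t - Y n i t) + (Y n i t - Y (n + (q - n)) i t)) by ring.
  eapply Rle_trans; [apply Rabs_triang|]; lra.
Qed.

Let I t := Rabs (t - a) < d.

Lemma picard_uniform i : (i <= N)%nat -> CVU_dom (fun n => Y n i) I.
Proof.
  intros Hi; apply CVU_dom_cauchy; intros eps.
  destruct (geometric_small (2 * M) eps (cond_pos eps)) as [n Hn].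
  exists n; intros p q t Ht Hp Hq.
  eapply Rle_lt_trans; [apply (picard_pair p q n)|]; eauto.
Qed.

Lemma picard_limit_seq i t : (i <= N)%nat -> I t ->
  is_lim_seq (fun n => Y n i t) (picard_limit N B a c i t).
Proof.
  intros Hi Ht; apply Lim_seq_correct'.
  apply (CVU_CVS_dom _ _ (picard_uniform i Hi) t Ht).
Qed.

Lemma picard_rhs_uniform i :
  (i <= N)%nat -> CVU_dom (fun n t => Derive (Y (S n) i) t) I.
Proof.
  intros Hi; apply CVU_dom_cauchy; intros eps.
  destruct (geometric_small (INR (S N) * C * (2 * M)) eps (cond_pos eps)) as [n Hn].
  exists n; intros p q t Ht Hp Hq.
  rewrite (is_derive_unique _ _ _ (picard_derive p i t Hi Ht)).
  rewrite (is_derive_unique _ _ _ (picard_derive q i t Hi Ht)).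
  unfold rhs; rewrite <- row_col_minus_r.
  eapply Rle_lt_trans; [apply (row_col_bound N _ _ C (2 * M * (/ 2) ^ n))|]; auto.
  - intros j Hj; apply HB; auto.
  - intros j Hj; apply picard_pair; auto.
  - rewrite <- Rmult_assoc; exact Hn.
Qed.

(** Both the iterates and their derivatives converge uniformly, so the limit
    may be differentiated term by term. *)
Lemma picard_limit_solves i t : (i <= N)%nat -> Rabs (t - a) < d ->
  is_derive (picard_limit N B a c i) t
    (row_col N (fun j => B i j t) (fun j => picard_limit N B a c j t)).
Proof.
  intros Hi Ht.
  assert (Iopen : open I).
  { intros s Hs'. assert (Hr : 0 < d - Rabs (s - a)) by (unfold I in Hs'; lra).
    exists (mkposreal _ Hr); intros r Hr'.
    change (Rabs (r - s) < d - Rabs (s - a)) in Hr'; unfold I.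
    replace (r - a) with ((r - s) + (s - a)) by ring.
    eapply Rle_lt_trans; [apply Rabs_triang|]; lra. }
  assert (Iconn : is_connected I).
  { intros r s x Hr Hs' Hx; unfold I in *.
    apply Rabs_def2 in Hr; apply Rabs_def2 in Hs'; apply Rabs_def1; lra. }
  pose proof (CVU_Derive (fun n => Y (S n) i) I Iopen Iconn) as D.
  assert (E : forall s, I s ->
     real (Lim_seq (fun n => Y (S n) i s)) = picard_limit N B a c i s).
  { intros s Hs'; unfold picard_limit; f_equal.
    apply (Lim_seq_incr_1 (fun n => Y n i s)). }
  apply (is_derive_ext_loc (fun s => real (Lim_seq (fun n => Y (S n) i s)))).
  { apply (filter_imp I); [exact E|apply Iopen; exact Ht]. }
  replace (row_col _ _ _) with (real (Lim_seq (fun n => Derive (Y (S n) i) t))).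
  - apply D; auto.
    + apply CVU_dom_cauchy; intros eps.
      destruct (proj1 (CVU_dom_cauchy _ _) (picard_uniform i Hi) eps) as [n Hn].
      exists n; intros; apply Hn; auto; lia.
    + intros n s Hs'; eexists; apply picard_derive; auto.
    + intros n s Hs'; apply continuity_pt_filterlim.
      apply (continuous_ext_loc _ (rhs n i)).
      * apply (filter_imp I); [|apply Iopen; exact Hs'].
        intros r Hr; symmetry; apply is_derive_unique, picard_derive; auto.
      * apply picard_rhs_continuous; auto.
    + apply picard_rhs_uniform; auto.
  - erewrite Lim_seq_ext; [|intros n; apply is_derive_unique, picard_derive; auto].
    unfold rhs.
    erewrite is_lim_seq_unique; [|apply is_lim_seq_row_col; intros j Hj;
      apply picard_limit_seq; auto].
    reflexivity.
Qed.

Lemma picard_limit_initial i : (i <= N)%nat -> picard_limit N B a c i a = c i.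
Proof.
  intros Hi; unfold picard_limit.
  rewrite (Lim_seq_ext _ (fun _ => c i)); [now rewrite Lim_seq_const|].
  intros n; apply picard_initial.
Qed.

End Picard.

(** * Functions of class C^n on an open set of the plane *)

Definition box (u0 v0 r : R) : R * R -> Prop :=
  fun p => Rabs (fst p - u0) < r /\ Rabs (snd p - v0) < r.

Lemma open_box u0 v0 r : open (box u0 v0 r).
Proof.
  intros [u v] [Hu Hv]; simpl in Hu, Hv.
  assert (Hd : 0 < Rmin (r - Rabs (u - u0)) (r - Rabs (v - v0)))
    by (apply Rmin_glb_lt; lra).
  exists (mkposreal _ Hd); intros [s t] [Hs Ht].
  change (Rabs (s - u) < Rmin (r - Rabs (u - u0)) (r - Rabs (v - v0))) in Hs.
  change (Rabs (t - v) < Rmin (r - Rabs (u - u0)) (r - Rabs (v - v0))) in Ht.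
  assert (Rabs (s - u) < r - Rabs (u - u0))
    by (eapply Rlt_le_trans; [exact Hs|apply Rmin_l]).
  assert (Rabs (t - v) < r - Rabs (v - v0))
    by (eapply Rlt_le_trans; [exact Ht|apply Rmin_r]).
  split; simpl.
  - replace (s - u0) with ((s - u) + (u - u0)) by ring.
    eapply Rle_lt_trans; [apply Rabs_triang|]; lra.
  - replace (t - v0) with ((t - v) + (v - v0)) by ring.
    eapply Rle_lt_trans; [apply Rabs_triang|]; lra.
Qed.

Lemma open_locally_2d (D : R * R -> Prop) u v :
  open D -> D (u, v) -> locally_2d (fun s t => D (s, t)) u v.
Proof.
  intros HO H; apply locally_2d_locally.
  apply (filter_imp D); [intros [s t]; auto|apply HO, H].
Qed.

Lemma open_locally_u (D : R * R -> Prop) u v :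
  open D -> D (u, v) -> locally u (fun s => D (s, v)).
Proof.
  intros HO H; apply (locally_2d_1d_const_y (fun s t => D (s, t))).
  now apply open_locally_2d.
Qed.

Lemma open_locally_v (D : R * R -> Prop) u v :
  open D -> D (u, v) -> locally v (fun t => D (u, t)).
Proof.
  intros HO H; apply (locally_2d_1d_const_x (fun s t => D (s, t))).
  now apply open_locally_2d.
Qed.

(** Carrying the partial derivatives as data, rather than as [Derive], lets an
    identity between them be proved and differentiability be recorded at once. *)
Definition has_partials (D : R * R -> Prop) (f P Q : R -> R -> R) : Prop :=
  forall u v, D (u, v) ->
    is_derive (fun s => f s v) u (P u v) /\ is_derive (fun t => f u t) v (Q u v).

Lemma has_partials_du (D : R * R -> Prop) f P Q u v :
  has_partials D f P Q -> D (u, v) -> du f u v = P u v.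
Proof. intros H Huv; apply is_derive_unique, (H u v Huv). Qed.

Lemma has_partials_dv (D : R * R -> Prop) f P Q u v :
  has_partials D f P Q -> D (u, v) -> dv f u v = Q u v.
Proof. intros H Huv; apply is_derive_unique, (H u v Huv). Qed.

Lemma has_partials_ext (D : R * R -> Prop) f g P Q P' Q' :
  open D ->
  (forall u v, D (u, v) -> f u v = g u v) ->
  (forall u v, D (u, v) -> P u v = P' u v) ->
  (forall u v, D (u, v) -> Q u v = Q' u v) ->
  has_partials D f P Q -> has_partials D g P' Q'.
Proof.
  intros HO Hfg HP HQ H u v Huv; destruct (H u v Huv) as [H1 H2].
  rewrite <- HP, <- HQ by auto; split.
  - apply (is_derive_ext_loc (fun s => f s v)); auto.
    apply (filter_imp (fun s => D (s, v))); auto using open_locally_u.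
  - apply (is_derive_ext_loc (fun t => f u t)); auto.
    apply (filter_imp (fun t => D (u, t))); auto using open_locally_v.
Qed.

Lemma has_partials_const (D : R * R -> Prop) c :
  has_partials D (fun _ _ => c) (fun _ _ => 0) (fun _ _ => 0).
Proof. intros u v _; split; apply (is_derive_const c). Qed.

Lemma has_partials_plus (D : R * R -> Prop) f g P Q P' Q' :
  has_partials D f P Q -> has_partials D g P' Q' ->
  has_partials D (fun u v => f u v + g u v)
    (fun u v => P u v + P' u v) (fun u v => Q u v + Q' u v).
Proof.
  intros Hf Hg u v H; destruct (Hf u v H), (Hg u v H); split;
    apply is_derive_Rplus; auto.
Qed.

Lemma has_partials_mult (D : R * R -> Prop) f g P Q P' Q' :
  has_partials D f P Q -> has_partials D g P' Q' ->
  has_partials D (fun u v => f u v * g u v)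
    (fun u v => P u v * g u v + f u v * P' u v)
    (fun u v => Q u v * g u v + f u v * Q' u v).
Proof.
  intros Hf Hg u v H; destruct (Hf u v H), (Hg u v H).
  split; [apply (Derive.is_derive_mult (fun s => f s v) (fun s => g s v))
         |apply (Derive.is_derive_mult (fun s => f u s) (fun s => g u s))]; auto.
Qed.

Lemma is_derive_Rcomp (g f : R -> R) t l m :
  is_derive g (f t) m -> is_derive f t l ->
  is_derive (fun s => g (f s)) t (m * l).
Proof.
  intros Hg Hf; rewrite Rmult_comm; now apply (is_derive_comp g f).
Qed.

Lemma has_partials_comp D (g g' : R -> R) f P Q :
  (forall u v, D (u, v) -> is_derive g (f u v) (g' (f u v))) ->
  has_partials D f P Q ->
  has_partials D (fun u v => g (f u v))
    (fun u v => g' (f u v) * P u v) (fun u v => g' (f u v) * Q u v).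
Proof.
  intros Hg Hf u v H; destruct (Hf u v H); split;
    [apply (is_derive_Rcomp g (fun s => f s v))
    |apply (is_derive_Rcomp g (fun s => f u s))]; auto.
Qed.

Definition Cn (D : R * R -> Prop) (n : nat) (f : R -> R -> R) : Prop :=
  forall u v, D (u, v) -> ex_diff_n f n u v.

Lemma smooth_Cn (D : R * R -> Prop) f : smooth D f <-> forall n, Cn D n f.
Proof. split; [intros H n u v Huv; now apply H|intros H u v Huv n; now apply H]. Qed.

Lemma Cn_0 (D : R * R -> Prop) f :
  Cn D 0 f <-> forall u v, D (u, v) -> continuity_2d_pt f u v.
Proof.
  split; [intros H u v Huv; apply (H u v Huv)|intros H u v Huv; split; auto].
Qed.

Lemma Cn_le (D : R * R -> Prop) n m f : (m <= n)%nat -> Cn D n f -> Cn D m f.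
Proof. intros Hm H u v Huv; apply (ex_diff_n_m n m Hm), H, Huv. Qed.

Lemma Cn_ext (D : R * R -> Prop) n f g : open D ->
  (forall u v, D (u, v) -> f u v = g u v) -> Cn D n f -> Cn D n g.
Proof.
  intros HO Hfg H u v Huv; apply (ex_diff_n_ext_loc f); auto.
  destruct (open_locally_2d D u v HO Huv) as [d Hd].
  exists d; intros; apply Hfg; auto.
Qed.

Lemma Cn_S_partials (D : R * R -> Prop) n f :
  Cn D (S n) f -> has_partials D f (du f) (dv f) /\ Cn D n (du f) /\ Cn D n (dv f).
Proof.
  intros H; split; [|split]; intros u v Huv;
    destruct (H u v Huv) as (_ & H1 & H2 & H3 & H4);
    auto; split; now apply Derive_correct.
Qed.

(** Bounded partial derivatives make [f] Lipschitz on a square. This starts the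
    bootstrap for a solution of a differential system, whose joint continuity is
    not known beforehand. *)
Lemma continuity_of_bounded_partials (f P Q : R -> R -> R) u v r K :
  0 < r -> has_partials (box u v r) f P Q ->
  (forall s t, box u v r (s, t) -> Rabs (P s t) <= K /\ Rabs (Q s t) <= K) ->
  continuity_2d_pt f u v.
Proof.
  intros Hr Hf HK eps.
  assert (K0 : 0 <= K).
  { eapply Rle_trans; [apply Rabs_pos|apply (HK u v)].
    split; simpl; rewrite Rminus_diag, Rabs_R0; auto. }
  assert (He : 0 < eps / (2 * K + 1))
    by (apply Rdiv_lt_0_compat; [apply cond_pos|lra]).
  assert (Hd : 0 < Rmin r (eps / (2 * K + 1))) by (apply Rmin_glb_lt; auto).
  exists (mkposreal _ Hd); simpl; intros s t Hs Ht.
  pose proof (Rlt_le_trans _ _ _ Hs (Rmin_l _ _)) as Hs1.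
  pose proof (Rlt_le_trans _ _ _ Ht (Rmin_l _ _)) as Ht1.
  pose proof (Rlt_le_trans _ _ _ Hs (Rmin_r _ _)) as Hs2.
  pose proof (Rlt_le_trans _ _ _ Ht (Rmin_r _ _)) as Ht2.
  assert (V1 : Rabs (f s t - f s v) <= K * Rabs (t - v)).
  { apply (bounded_variation (fun t => f s t) (fun t => Q s t)).
    intros x Hx; assert (Hb : box u v r (s, x)) by (split; simpl; lra).
    split; [apply Hf|apply HK]; auto. }
  assert (V2 : Rabs (f s v - f u v) <= K * Rabs (s - u)).
  { apply (bounded_variation (fun s => f s v) (fun s => P s v)).
    intros x Hx; assert (Hb : box u v r (x, v)).
    { split; simpl; [lra|]; rewrite Rminus_diag, Rabs_R0; auto. }
    split; [apply Hf|apply HK]; auto. }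
  replace (f s t - f u v) with ((f s t - f s v) + (f s v - f u v)) by ring.
  eapply Rle_lt_trans; [apply Rabs_triang|].
  assert (E : (2 * K + 1) * (eps / (2 * K + 1)) = eps) by (field; lra).
  assert (K * Rabs (t - v) <= K * (eps / (2 * K + 1)))
    by (apply Rmult_le_compat_l; lra).
  assert (K * Rabs (s - u) <= K * (eps / (2 * K + 1)))
    by (apply Rmult_le_compat_l; lra).
  lra.
Qed.

Lemma continuity_2d_bounded f u v : continuity_2d_pt f u v ->
  locally_2d (fun s t => Rabs (f s t) <= Rabs (f u v) + 1) u v.
Proof.
  intros H; destruct (H (mkposreal 1 Rlt_0_1)) as [d Hd].
  exists d; intros s t Hs Ht; specialize (Hd s t Hs Ht); simpl in Hd.
  replace (f s t) with ((f s t - f u v) + f u v) by ring.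
  eapply Rle_trans; [apply Rabs_triang|]; lra.
Qed.

(** The bootstrapping step: the regularity of a function is read off from the
    right-hand sides of the equations it satisfies. *)
Lemma Cn_S_intro (D : R * R -> Prop) n f P Q :
  open D -> has_partials D f P Q -> Cn D n P -> Cn D n Q -> Cn D (S n) f.
Proof.
  intros HO Hf HP HQ u v Huv.
  destruct (Hf u v Huv) as [H1 H2].
  split; [|split; [|split; [|split]]].
  - pose proof (proj1 (Cn_0 D P) (Cn_le D n 0 P (Nat.le_0_l n) HP) u v Huv) as CP.
    pose proof (proj1 (Cn_0 D Q) (Cn_le D n 0 Q (Nat.le_0_l n) HQ) u v Huv) as CQ.
    pose proof (locally_2d_and _ _ u v (open_locally_2d D u v HO Huv)
      (locally_2d_and _ _ u v (continuity_2d_bounded _ _ _ CP)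
                              (continuity_2d_bounded _ _ _ CQ))) as [d Hd].
    apply (continuity_of_bounded_partials f P Q u v d
             (Rabs (P u v) + 1 + (Rabs (Q u v) + 1))); [apply cond_pos| |].
    + intros s t [Hs Ht]; apply Hf, (Hd s t Hs Ht).
    + intros s t [Hs Ht]; destruct (Hd s t Hs Ht) as (_ & ? & ?).
      pose proof (Rabs_pos (P u v)); pose proof (Rabs_pos (Q u v)); lra.
  - eexists; exact H1.
  - eexists; exact H2.
  - apply (Cn_ext D n P); auto.
    intros s t Hst; symmetry; apply (has_partials_du D f P Q); auto.
  - apply (Cn_ext D n Q); auto.
    intros s t Hst; symmetry; apply (has_partials_dv D f P Q); auto.
Qed.

Lemma Cn_const (D : R * R -> Prop) n c : open D -> Cn D n (fun _ _ => c).
Proof.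
  intros HO; revert c; induction n as [|n IH]; intros c.
  - apply Cn_0; intros; apply continuity_2d_pt_const.
  - apply (Cn_S_intro D n _ (fun _ _ => 0) (fun _ _ => 0)); auto.
    apply has_partials_const.
Qed.

Lemma Cn_plus (D : R * R -> Prop) n f g : open D ->
  Cn D n f -> Cn D n g -> Cn D n (fun u v => f u v + g u v).
Proof.
  intros HO; revert f g; induction n as [|n IH]; intros f g Hf Hg.
  - apply Cn_0; intros u v Huv; apply continuity_2d_pt_plus;
      [apply (proj1 (Cn_0 D f))|apply (proj1 (Cn_0 D g))]; auto.
  - destruct (Cn_S_partials _ _ _ Hf) as (Pf & Uf & Vf).
    destruct (Cn_S_partials _ _ _ Hg) as (Pg & Ug & Vg).
    eapply Cn_S_intro;
      [auto|apply has_partials_plus; eassumption|apply IH; auto|apply IH; auto].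
Qed.

Lemma Cn_mult (D : R * R -> Prop) n f g : open D ->
  Cn D n f -> Cn D n g -> Cn D n (fun u v => f u v * g u v).
Proof.
  intros HO; revert f g; induction n as [|n IH]; intros f g Hf Hg.
  - apply Cn_0; intros u v Huv; apply continuity_2d_pt_mult;
      [apply (proj1 (Cn_0 D f))|apply (proj1 (Cn_0 D g))]; auto.
  - destruct (Cn_S_partials _ _ _ Hf) as (Pf & Uf & Vf).
    destruct (Cn_S_partials _ _ _ Hg) as (Pg & Ug & Vg).
    assert (Hf' : Cn D n f) by (apply (Cn_le D (S n)); auto).
    assert (Hg' : Cn D n g) by (apply (Cn_le D (S n)); auto).
    eapply Cn_S_intro; [auto|apply has_partials_mult; eassumption| |];
      apply Cn_plus; auto.
Qed.

(** The partial derivatives of [1/f] are polynomials in [1/f] and those of [f],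
    so regularity bootstraps from continuity. *)
Lemma Cn_inv (D : R * R -> Prop) n f : open D -> (forall u v, D (u, v) -> f u v <> 0) ->
  Cn D n f -> Cn D n (fun u v => / f u v).
Proof.
  intros HO Hnz; induction n as [|n IH]; intros Hf.
  - apply Cn_0; intros u v Huv; apply continuity_2d_pt_inv; auto.
    apply (proj1 (Cn_0 D f)); auto.
  - destruct (Cn_S_partials _ _ _ Hf) as (Pf & Uf & Vf).
    assert (Hi : Cn D n (fun u v => / f u v)) by (apply IH, (Cn_le D (S n)); auto).
    assert (Hs : Cn D n (fun u v => -1 * (/ f u v * / f u v)))
      by (apply Cn_mult; auto using Cn_const, Cn_mult).
    eapply (Cn_S_intro D n _
      (fun u v => -1 * (/ f u v * / f u v) * du f u v)
      (fun u v => -1 * (/ f u v * / f u v) * dv f u v)); auto using Cn_mult.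
    apply (has_partials_comp D Rinv (fun x => -1 * (/ x * / x))); auto.
    intros u v Huv; replace (-1 * (/ f u v * / f u v)) with (- 1 / f u v ^ 2)
      by (field; auto).
    apply (is_derive_inv (fun x => x)); [apply (is_derive_id (f u v))|auto].
Qed.

Section SmoothAlgebra.
Variable D : R * R -> Prop.
Hypothesis HO : open D.

Lemma smooth_const c : smooth D (fun _ _ => c).
Proof. apply smooth_Cn; intros; now apply Cn_const. Qed.

Lemma smooth_plus f g : smooth D f -> smooth D g -> smooth D (fun u v => f u v + g u v).
Proof. rewrite !smooth_Cn; intros; apply Cn_plus; auto. Qed.

Lemma smooth_mult f g : smooth D f -> smooth D g -> smooth D (fun u v => f u v * g u v).
Proof. rewrite !smooth_Cn; intros; apply Cn_mult; auto. Qed.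

Lemma smooth_inv f : (forall u v, D (u, v) -> f u v <> 0) ->
  smooth D f -> smooth D (fun u v => / f u v).
Proof. rewrite !smooth_Cn; intros; apply Cn_inv; auto. Qed.

Lemma smooth_opp f : smooth D f -> smooth D (fun u v => - f u v).
Proof.
  intros Hf; assert (E : smooth D (fun u v => -1 * f u v))
    by (apply smooth_mult; auto using smooth_const).
  rewrite smooth_Cn in *; intros n; apply (Cn_ext D n (fun u v => -1 * f u v)); auto.
  intros; ring.
Qed.

Lemma smooth_ext f g : (forall u v, D (u, v) -> f u v = g u v) ->
  smooth D f -> smooth D g.
Proof. rewrite !smooth_Cn; intros E H n; apply (Cn_ext D n f); auto. Qed.

Lemma smooth_intro f P Q :
  has_partials D f P Q -> smooth D P -> smooth D Q -> smooth D f.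
Proof.
  rewrite !smooth_Cn; intros Hf HP HQ n; apply (Cn_le D (S n)); [lia|].
  apply (Cn_S_intro D n f P Q); auto.
Qed.

Lemma smooth_partials f : smooth D f -> has_partials D f (du f) (dv f).
Proof. rewrite smooth_Cn; intros H; apply (Cn_S_partials D 0), H. Qed.

Lemma smooth_du f : smooth D f -> smooth D (du f).
Proof. rewrite !smooth_Cn; intros H n; apply (Cn_S_partials D n), H. Qed.

Lemma smooth_dv f : smooth D f -> smooth D (dv f).
Proof. rewrite !smooth_Cn; intros H n; apply (Cn_S_partials D n), H. Qed.

Lemma smooth_continuity f u v : smooth D f -> D (u, v) -> continuity_2d_pt f u v.
Proof. intros H Huv; apply (H u v Huv 0%nat). Qed.

Lemma smooth_schwarz f u v : smooth D f -> D (u, v) -> dv (du f) u v = du (dv f) u v.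
Proof.
  intros Hf Huv; symmetry; apply Schwarz.
  - destruct (open_locally_2d D u v HO Huv) as [d Hd]; exists d.
    intros s t Hs Ht; specialize (Hd s t Hs Ht).
    pose proof (smooth_partials f Hf s t Hd) as [A1 A2].
    pose proof (smooth_partials _ (smooth_du f Hf) s t Hd) as [_ A3].
    pose proof (smooth_partials _ (smooth_dv f Hf) s t Hd) as [A4 _].
    repeat split; eexists; eassumption.
  - apply (smooth_continuity (du (dv f))); auto using smooth_du, smooth_dv.
  - apply (smooth_continuity (dv (du f))); auto using smooth_du, smooth_dv.
Qed.

End SmoothAlgebra.

Lemma smooth_subset (D D' : R * R -> Prop) f :
  (forall p, D' p -> D p) -> smooth D f -> smooth D' f.
Proof. intros Hs H u v Huv n; apply H, Hs, Huv. Qed.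

(** * Integrable linear Pfaffian systems *)

Lemma filter_forall_le {T : Type} (F : (T -> Prop) -> Prop) {FF : Filter F}
    (N : nat) (P : nat -> T -> Prop) :
  (forall i, (i <= N)%nat -> F (P i)) ->
  F (fun x => forall i, (i <= N)%nat -> P i x).
Proof.
  intros H.
  assert (G : forall n, (n <= N)%nat -> F (fun x => forall i, (i <= n)%nat -> P i x)).
  { induction n as [|n IH]; intros Hn.
    - apply (filter_imp (P 0%nat)); auto.
      intros x Hx i Hi; now replace i with 0%nat by lia.
    - apply (filter_imp (fun x => (forall i, (i <= n)%nat -> P i x) /\ P (S n) x)).
      + intros x [H1 H2] i Hi; destruct (Nat.eq_dec i (S n)) as [->|]; auto.
        apply H1; lia.
      + apply filter_and; [apply IH; lia|auto]. }
  now apply G.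
Qed.

Lemma nat_family_bound (N : nat) (c : nat -> R) :
  exists M, 0 <= M /\ forall i, (i <= N)%nat -> Rabs (c i) <= M.
Proof.
  induction N as [|N [M [M0 HM]]].
  - exists (Rabs (c 0%nat)); split; [apply Rabs_pos|].
    intros i Hi; replace i with 0%nat by lia; lra.
  - exists (M + Rabs (c (S N))); pose proof (Rabs_pos (c (S N))); split; [lra|].
    intros i Hi; destruct (Nat.eq_dec i (S N)) as [->|]; [lra|].
    assert (Hi' : (i <= N)%nat) by lia; specialize (HM i Hi'); lra.
Qed.

Lemma family_locally_bounded N (f : nat -> nat -> R -> R -> R) u0 v0 :
  (forall i j, (i <= N)%nat -> (j <= N)%nat -> continuity_2d_pt (f i j) u0 v0) ->
  exists C r, 0 <= C /\ 0 < r /\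
    forall i j u v, (i <= N)%nat -> (j <= N)%nat -> box u0 v0 r (u, v) ->
      Rabs (f i j u v) <= C.
Proof.
  intros Hf.
  assert (L : locally (u0, v0) (fun p => forall i, (i <= N)%nat ->
    forall j, (j <= N)%nat ->
      Rabs (f i j (fst p) (snd p)) <= Rabs (f i j u0 v0) + 1)).
  { apply (filter_forall_le (locally (u0, v0)) N (fun i p => forall j, (j <= N)%nat ->
      Rabs (f i j (fst p) (snd p)) <= Rabs (f i j u0 v0) + 1)); intros i Hi.
    apply (filter_forall_le (locally (u0, v0)) N (fun j p =>
      Rabs (f i j (fst p) (snd p)) <= Rabs (f i j u0 v0) + 1)); intros j Hj.
    apply (locally_2d_locally (fun s t => Rabs (f i j s t) <= Rabs (f i j u0 v0) + 1)).
    now apply continuity_2d_bounded, Hf. }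
  assert (HB : exists C, 0 <= C /\ forall i, (i <= N)%nat -> forall j, (j <= N)%nat ->
    Rabs (f i j u0 v0) <= C).
  { assert (G : forall n, exists C, 0 <= C /\ forall i, (i <= n)%nat ->
      forall j, (j <= N)%nat -> Rabs (f i j u0 v0) <= C).
    { induction n as [|n [C [C0 HC]]].
      - destruct (nat_family_bound N (fun j => f 0%nat j u0 v0)) as [M [M0 HM]].
        exists M; split; auto; intros i Hi; replace i with 0%nat by lia; auto.
      - destruct (nat_family_bound N (fun j => f (S n) j u0 v0)) as [M [M0 HM]].
        exists (C + M); split; [lra|]; intros i Hi j Hj.
        destruct (Nat.eq_dec i (S n)) as [->|].
        + specialize (HM j Hj); lra.
        + assert (Hi' : (i <= n)%nat) by lia; specialize (HC i Hi' j Hj); lra. }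
    apply G. }
  destruct HB as [C [C0 HC]].
  apply (locally_2d_locally (fun s t => forall i, (i <= N)%nat ->
    forall j, (j <= N)%nat -> Rabs (f i j s t) <= Rabs (f i j u0 v0) + 1)) in L.
  destruct L as [d Hd].
  exists (C + 1), d; split; [lra|]; split; [apply cond_pos|].
  intros i j u v Hi Hj [Hu Hv]; specialize (Hd u v Hu Hv i Hi j Hj).
  specialize (HC i Hi j Hj); lra.
Qed.

(** The form in which an estimate on increments becomes a derivative. *)
Lemma is_derive_remainder (f : R -> R) (x l : R) :
  is_derive f x l <-> forall eps : posreal,
    locally x (fun y => Rabs (f y - f x - (y - x) * l) <= eps * Rabs (y - x)).
Proof.
  split.
  - intros [_ H]; exact (H x (fun P HP => HP)).
  - intros H; split; [apply is_linear_scal_l|].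
    intros y Hy; rewrite <- (is_filter_lim_locally_unique x y Hy); exact H.
Qed.

(** Along each line [u = const] the increment of [Y] in the direction of [u],
    minus its expected linear part, solves the same linear equation up to a
    forcing term of second order; this is where integrability enters. The
    short-time estimate then carries first-order smallness from [v = v0] to
    every [v]. *)
Lemma transverse_derivative N (A B Av Bu Buu : nat -> nat -> R -> R -> R)
    (Y : nat -> R -> R -> R) (u0 v0 r C M : R) :
  0 <= C -> INR (S N) * C * r <= / 2 -> 0 <= M ->
  (forall i j u v, (i <= N)%nat -> (j <= N)%nat -> box u0 v0 r (u, v) ->
     (Rabs (A i j u v) <= C /\ Rabs (B i j u v) <= C /\
      Rabs (Bu i j u v) <= C /\ Rabs (Buu i j u v) <= C) /\
     is_derive (fun t => A i j u t) v (Av i j u v) /\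
     is_derive (fun s => B i j s v) u (Bu i j u v) /\
     is_derive (fun s => Bu i j s v) u (Buu i j u v) /\
     Av i j u v + row_col N (fun k => A i k u v) (fun k => B k j u v)
       = Bu i j u v + row_col N (fun k => B i k u v) (fun k => A k j u v)) ->
  (forall i u v, (i <= N)%nat -> box u0 v0 r (u, v) ->
     Rabs (Y i u v) <= M /\
     is_derive (fun t => Y i u t) v
       (row_col N (fun j => B i j u v) (fun j => Y j u v))) ->
  (forall i u, (i <= N)%nat -> Rabs (u - u0) < r ->
     is_derive (fun s => Y i s v0) u
       (row_col N (fun j => A i j u v0) (fun j => Y j u v0))) ->
  forall i u v, (i <= N)%nat -> box u0 v0 r (u, v) ->
    is_derive (fun s => Y i s v) u
      (row_col N (fun j => A i j u v) (fun j => Y j u v)).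
Proof.
  intros HC Hr HM Hco HY HY0 i u v Hi [Hu Hv]; simpl in Hu, Hv.
  set (AY := fun i t => row_col N (fun j => A i j u t) (fun j => Y j u t)).
  assert (Hr0 : 0 < r) by (pose proof (Rabs_pos (u - u0)); lra).
  set (n := INR (S N)) in *.
  assert (Hn : 0 <= n) by apply pos_INR.
  (* [K (s - u)^2] will bound the forcing term: the first summand comes from the
     Taylor remainder of [B] against [Y], the second from the increment of [B]
     against [A Y], itself bounded by [n C M]. *)
  set (K := n * C * M + n * C * (n * C * M)).
  assert (HnCM : 0 <= n * C * M) by (repeat apply Rmult_le_pos; auto).
  assert (HK : 0 <= K).
  { unfold K; apply Rplus_le_le_0_compat; auto.
    repeat apply Rmult_le_pos; auto. }
  assert (Htr : forall t, Rabs (t - v0) <= Rabs (v - v0) -> Rabs (t - v0) < r)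
    by (intros; lra).
  apply is_derive_remainder; intros eps.
  assert (L1 : locally u (fun s => forall k, (k <= N)%nat ->
    Rabs (Y k s v0 - Y k u v0 - (s - u) * AY k v0) <= eps / 4 * Rabs (s - u))).
  { apply (filter_forall_le (locally u) N (fun k s =>
      Rabs (Y k s v0 - Y k u v0 - (s - u) * AY k v0) <= eps / 4 * Rabs (s - u)));
      intros k Hk.
    assert (He : 0 < eps / 4) by (pose proof (cond_pos eps); lra).
    apply (proj1 (is_derive_remainder (fun s => Y k s v0) u _) (HY0 k u Hk Hu)
             (mkposreal _ He)). }
  assert (L2 : locally u (fun s => Rabs (s - u) <= r - Rabs (u - u0) /\
    Rabs (s - u) < r - Rabs (u - u0))).
  { assert (Hd : 0 < r - Rabs (u - u0)) by lra.
    exists (mkposreal _ Hd); intros s Hs.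
    change (Rabs (s - u) < r - Rabs (u - u0)) in Hs; lra. }
  assert (L3 : locally u (fun s => 4 * (r * K + 1) * Rabs (s - u) <= eps)).
  { assert (HrK : 0 <= r * K) by (apply Rmult_le_pos; lra).
    assert (Hd : 0 < eps / (4 * (r * K + 1)))
      by (apply Rdiv_lt_0_compat; [apply cond_pos|lra]).
    exists (mkposreal _ Hd); intros s Hs.
    change (Rabs (s - u) < eps / (4 * (r * K + 1))) in Hs.
    replace (pos eps) with (4 * (r * K + 1) * (eps / (4 * (r * K + 1))))
      by (field; lra).
    apply Rmult_le_compat_l; lra. }
  generalize (filter_and _ _ L1 (filter_and _ _ L2 L3)); apply filter_imp.
  intros s (S1 & [_ S2] & S3).
  assert (Hbox : forall x t, Rabs (x - u) <= Rabs (s - u) ->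
    Rabs (t - v0) < r -> box u0 v0 r (x, t)).
  { intros x t Hx Ht; split; simpl; auto.
    replace (x - u0) with ((x - u) + (u - u0)) by ring.
    eapply Rle_lt_trans; [apply Rabs_triang|]; lra. }
  assert (Hbs : forall t, Rabs (t - v0) < r -> box u0 v0 r (s, t))
    by (intros; apply Hbox; auto; lra).
  assert (Hbu : forall t, Rabs (t - v0) < r -> box u0 v0 r (u, t)).
  { intros; apply Hbox; auto; rewrite Rminus_diag, Rabs_R0; apply Rabs_pos. }
  assert (HAY : forall k t, (k <= N)%nat -> Rabs (t - v0) < r ->
    Rabs (AY k t) <= n * C * M).
  { intros k t Hk Ht; apply row_col_bound; auto; intros j Hj;
      [apply Hco|apply HY]; auto. }
  assert (HAYd : forall k t, (k <= N)%nat -> Rabs (t - v0) < r ->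
    is_derive (AY k) t (row_col N (fun j => Bu k j u t) (fun j => Y j u t)
                        + row_col N (fun j => B k j u t) (fun j => AY j t))).
  { intros k t Hk Ht; unfold AY.
    replace (_ + _) with
      (row_col N (fun j => Av k j u t) (fun j => Y j u t) +
       row_col N (fun j => A k j u t)
         (fun m => row_col N (fun j => B m j u t) (fun j => Y j u t))).
    - apply (is_derive_row_col N (fun j t => A k j u t) (fun j t => Y j u t)
        (fun j => Av k j u t)
        (fun m => row_col N (fun j => B m j u t) (fun j => Y j u t))).
      + intros j Hj; apply Hco; auto.
      + intros j Hj; apply HY; auto.
    - (* Integrability replaces [A_v + A B] by [B_u + B A]. *)
      rewrite !row_col_assoc, <- !row_col_plus_l.
      apply row_col_ext; auto; intros j Hj; apply Hco; auto. }
  assert (HB1 : forall k j t, (k <= N)%nat -> (j <= N)%nat -> Rabs (t - v0) < r ->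
    Rabs (B k j s t - B k j u t) <= C * Rabs (s - u)).
  { intros k j t Hk Hj Ht.
    apply (bounded_variation (fun s => B k j s t) (fun s => Bu k j s t)).
    intros x Hx; split; apply Hco; auto. }
  (* Taylor's formula at order two, from the mean value inequality applied to
     [B - s B_u(u)] and then to [B_u]. *)
  assert (HB2 : forall k j t, (k <= N)%nat -> (j <= N)%nat -> Rabs (t - v0) < r ->
    Rabs (B k j s t - B k j u t - (s - u) * Bu k j u t)
      <= C * Rabs (s - u) * Rabs (s - u)).
  { intros k j t Hk Hj Ht.
    replace (B k j s t - B k j u t - (s - u) * Bu k j u t) with
      ((B k j s t - s * Bu k j u t) - (B k j u t - u * Bu k j u t)) by ring.
    apply (bounded_variation (fun s => B k j s t - s * Bu k j u t)
             (fun s => Bu k j s t - Bu k j u t)).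
    intros x Hx; split.
    - apply is_derive_Rminus; [apply Hco; auto|].
      apply (is_derive_value _ _ (1 * Bu k j u t + x * 0)); [|ring].
      apply (Derive.is_derive_mult (fun s => s) (fun _ => Bu k j u t));
        [apply (is_derive_id x)|apply (is_derive_const (Bu k j u t))].
    - apply Rle_trans with (C * Rabs (x - u)); [|apply Rmult_le_compat_l; auto].
      apply (bounded_variation (fun s => Bu k j s t) (fun s => Buu k j s t)).
      intros y Hy; split; apply Hco; auto; apply Hbox; auto; lra. }
  set (h := Rabs (s - u)) in *.
  assert (Hh : 0 <= h) by apply Rabs_pos.
  assert (Est : Rabs (Y i s v - Y i u v - (s - u) * AY i v)
                <= 2 * (eps / 4 * h + Rabs (v - v0) * (K * h * h))).
  { apply (short_time_estimate N (fun i j t => B i j s t)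
      (fun k t => Y k s t - Y k u t - (s - u) * AY k t)
      (fun k t => row_col N (fun j => B k j s t - B k j u t - (s - u) * Bu k j u t)
                    (fun j => Y j u t)
        + (s - u) * row_col N (fun j => B k j s t - B k j u t) (fun j => AY j t))
      v0 (Rabs (v - v0)) C); auto using Rabs_pos; try lra.
    - eapply Rle_trans; [|apply Hr]; apply Rmult_le_compat_l; [|lra].
      apply Rmult_le_pos; auto.
    - intros k j t Hk Hj Ht; apply Hco; auto.
    - intros k t Hk Ht.
      eapply Rle_trans; [apply Rabs_triang|].
      assert (E1 : Rabs (row_col N
        (fun j => B k j s t - B k j u t - (s - u) * Bu k j u t) (fun j => Y j u t))
        <= n * (C * h * h) * M).
      { apply row_col_bound; auto.
        - repeat apply Rmult_le_pos; auto.
        - intros j Hj; apply HY; auto. }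
      assert (E2 : Rabs (row_col N (fun j => B k j s t - B k j u t) (fun j => AY j t))
        <= n * (C * h) * (n * C * M)).
      { apply row_col_bound; auto. apply Rmult_le_pos; auto. }
      rewrite Rabs_mult; fold h.
      assert (E3 : h * Rabs (row_col N (fun j => B k j s t - B k j u t) (fun j => AY j t))
        <= h * (n * (C * h) * (n * C * M))) by (apply Rmult_le_compat_l; auto).
      replace (K * h * h) with
        (n * (C * h * h) * M + h * (n * (C * h) * (n * C * M)))
        by (unfold K; ring).
      lra.
    - intros k t Hk Ht.
      match goal with |- is_derive _ _ ?l => replace l with
        (row_col N (fun j => B k j s t) (fun j => Y j s t)
         - row_col N (fun j => B k j u t) (fun j => Y j u t)
         - (0 * AY k t + (s - u) * (row_col N (fun j => Bu k j u t) (fun j => Y j u t)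
            + row_col N (fun j => B k j u t) (fun j => AY j t)))) end.
      + apply is_derive_Rminus; [apply is_derive_Rminus; apply HY; auto|].
        apply (Derive.is_derive_mult (fun _ => s - u) (AY k));
          [apply (is_derive_const (s - u))|auto].
      + rewrite (row_col_minus_r N _ (fun j => Y j s t - Y j u t)
          (fun j => (s - u) * AY j t)), row_col_minus_r, row_col_scal_r.
        rewrite (row_col_minus_l N (fun j => B k j s t - B k j u t)
          (fun j => (s - u) * Bu k j u t)), !row_col_minus_l, row_col_scal_l.
        ring. }
  eapply Rle_trans; [exact Est|].
  assert (Q1 : 0 <= K * h * h) by (repeat apply Rmult_le_pos; auto).
  assert (Q2 : Rabs (v - v0) * (K * h * h) <= r * (K * h * h))
    by (apply Rmult_le_compat_r; lra).
  assert (Q3 : 4 * (r * K + 1) * h * h <= eps * h) by (apply Rmult_le_compat_r; auto).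
  assert (0 <= h * h) by (apply Rmult_le_pos; auto).
  lra.
Qed.

Definition solves_pfaff (N : nat) (D : R * R -> Prop)
    (A B : nat -> nat -> R -> R -> R) (Y : nat -> R -> R -> R) : Prop :=
  forall i, (i <= N)%nat -> has_partials D (Y i)
    (fun u v => row_col N (fun j => A i j u v) (fun j => Y j u v))
    (fun u v => row_col N (fun j => B i j u v) (fun j => Y j u v)).

Lemma Cn_row_col N (D : R * R -> Prop) (a y : nat -> R -> R -> R) n : open D ->
  (forall j, (j <= N)%nat -> Cn D n (a j)) ->
  (forall j, (j <= N)%nat -> Cn D n (y j)) ->
  Cn D n (fun u v => row_col N (fun j => a j u v) (fun j => y j u v)).
Proof.
  intros HO Ha Hy; unfold row_col.
  assert (G : forall M, (M <= N)%nat ->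
    Cn D n (fun u v => sum_f_R0 (fun j => a j u v * y j u v) M)).
  { induction M as [|M IH]; intros HM; simpl.
    - apply Cn_mult; auto.
    - apply Cn_plus; auto; [apply IH; lia|apply Cn_mult; auto]. }
  apply G; lia.
Qed.

(** Frobenius' theorem for linear systems. The equation in [v] holds by
    construction when one solves along [v = v0] and then along every line
    [u = const]; integrability yields the one in [u]. The size of the square
    does not depend on the initial value, because the system is linear. *)
Lemma pfaff_solvable N (A B : nat -> nat -> R -> R -> R) (D : R * R -> Prop)
    (u0 v0 : R) :
  open D -> D (u0, v0) ->
  (forall i j, (i <= N)%nat -> (j <= N)%nat -> smooth D (A i j) /\ smooth D (B i j)) ->
  (forall i j u v, (i <= N)%nat -> (j <= N)%nat -> D (u, v) ->
     dv (A i j) u v + row_col N (fun k => A i k u v) (fun k => B k j u v)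
     = du (B i j) u v + row_col N (fun k => B i k u v) (fun k => A k j u v)) ->
  exists r, 0 < r /\ (forall p, box u0 v0 r p -> D p) /\
    (forall c : nat -> R, exists Y : nat -> R -> R -> R,
       (forall i, (i <= N)%nat -> Y i u0 v0 = c i) /\
       (forall i, (i <= N)%nat -> smooth (box u0 v0 r) (Y i)) /\
       solves_pfaff N (box u0 v0 r) A B Y) /\
    (forall Y Z : nat -> R -> R -> R,
       (forall i, (i <= N)%nat -> Y i u0 v0 = Z i u0 v0) ->
       solves_pfaff N (box u0 v0 r) A B Y -> solves_pfaff N (box u0 v0 r) A B Z ->
       forall i u v, (i <= N)%nat -> box u0 v0 r (u, v) -> Y i u v = Z i u v).
Proof.
  intros HO H0 Hsm Hint.
  assert (Hbd : forall f, (forall i j, (i <= N)%nat -> (j <= N)%nat -> smooth D (f i j)) ->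
    exists C r, 0 <= C /\ 0 < r /\
      forall i j u v, (i <= N)%nat -> (j <= N)%nat -> box u0 v0 r (u, v) ->
        Rabs (f i j u v) <= C).
  { intros f Hf; apply family_locally_bounded; intros i j Hi Hj.
    apply (smooth_continuity D); auto. }
  destruct (Hbd A) as (CA & rA & CA0 & rA0 & HA); [intros; apply Hsm; auto|].
  destruct (Hbd B) as (CB & rB & CB0 & rB0 & HB); [intros; apply Hsm; auto|].
  destruct (Hbd (fun i j => du (B i j))) as (C1 & r1 & C10 & r10 & H1);
    [intros; apply smooth_du, Hsm; auto|].
  destruct (Hbd (fun i j => du (du (B i j)))) as (C2 & r2 & C20 & r20 & H2);
    [intros; apply smooth_du, smooth_du, Hsm; auto|].
  destruct (open_locally_2d D u0 v0 HO H0) as [rD HD].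
  set (C := CA + CB + C1 + C2).
  assert (HC : 0 <= C) by (unfold C; lra).
  set (n := INR (S N)).
  assert (Hn : 0 <= n) by apply pos_INR.
  assert (HnC : 0 <= n * C) by (apply Rmult_le_pos; auto).
  assert (Hsmall : 0 < / (2 * (n * C + 1))) by (apply Rinv_0_lt_compat; lra).
  assert (Hr : exists r, 0 < r /\ r <= rA /\ r <= rB /\ r <= r1 /\ r <= r2 /\
    r <= rD /\ r <= / (2 * (n * C + 1))).
  { exists (Rmin (Rmin (Rmin rA rB) (Rmin r1 r2)) (Rmin rD (/ (2 * (n * C + 1))))).
    split; [repeat apply Rmin_glb_lt; auto; apply cond_pos|].
    pose proof (Rmin_l rA rB); pose proof (Rmin_r rA rB).
    pose proof (Rmin_l r1 r2); pose proof (Rmin_r r1 r2).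
    pose proof (Rmin_l rD (/ (2 * (n * C + 1)))).
    pose proof (Rmin_r rD (/ (2 * (n * C + 1)))).
    pose proof (Rmin_l (Rmin rA rB) (Rmin r1 r2)).
    pose proof (Rmin_r (Rmin rA rB) (Rmin r1 r2)).
    pose proof (Rmin_l (Rmin (Rmin rA rB) (Rmin r1 r2)) (Rmin rD (/ (2 * (n * C + 1))))).
    pose proof (Rmin_r (Rmin (Rmin rA rB) (Rmin r1 r2)) (Rmin rD (/ (2 * (n * C + 1))))).
    repeat split; lra. }
  destruct Hr as (r & r0 & rA1 & rB1 & r11 & r21 & rD1 & rs).
  assert (HnCr : n * C * r <= / 2).
  { apply Rle_trans with (n * C * / (2 * (n * C + 1))).
    - apply Rmult_le_compat_l; auto.
    - apply (Rmult_le_reg_r (2 * (n * C + 1))); [lra|].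
      rewrite Rmult_assoc, Rinv_l; lra. }
  assert (HbD : forall p, box u0 v0 r p -> D p).
  { intros [u v] [Hu Hv]; simpl in Hu, Hv; apply HD; lra. }
  assert (Hbox : forall r' u v, r <= r' -> box u0 v0 r (u, v) -> box u0 v0 r' (u, v)).
  { intros r' u v Hle [Hu Hv]; split; simpl in *; lra. }
  assert (Hcoef : forall i j u v, (i <= N)%nat -> (j <= N)%nat ->
    box u0 v0 r (u, v) ->
    Rabs (A i j u v) <= C /\ Rabs (B i j u v) <= C /\
    Rabs (du (B i j) u v) <= C /\ Rabs (du (du (B i j)) u v) <= C).
  { intros i j u v Hi Hj Huv; unfold C.
    specialize (HA i j u v Hi Hj (Hbox rA u v rA1 Huv)).
    specialize (HB i j u v Hi Hj (Hbox rB u v rB1 Huv)).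
    specialize (H1 i j u v Hi Hj (Hbox r1 u v r11 Huv)).
    specialize (H2 i j u v Hi Hj (Hbox r2 u v r21 Huv)).
    simpl in *; lra. }
  assert (Hbu : forall u, Rabs (u - u0) < r -> box u0 v0 r (u, v0)).
  { intros u Hu; split; simpl; auto; rewrite Rminus_diag, Rabs_R0; auto. }
  exists r; split; [auto|]; split; [auto|]; split.
  - intros c.
    (* Each of the two integrations at most doubles the bound [M] on the initial
       values, whence [2 * M] on the axis and [2 * (2 * M)] on the square. *)
    destruct (nat_family_bound N c) as [M [M0 HM]].
    assert (contA : forall i j t, (i <= N)%nat -> (j <= N)%nat -> Rabs (t - u0) < r ->
      continuous (fun t => A i j t v0) t /\ Rabs (A i j t v0) <= C).
    { intros i j t Hi Hj Ht; split; [|apply Hcoef; auto].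
      apply (ex_derive_continuous (fun t => A i j t v0)); exists (du (A i j) t v0).
      apply (smooth_partials D (A i j)); [apply Hsm; auto|auto]. }
    assert (contB : forall u, Rabs (u - u0) < r ->
      forall i j t, (i <= N)%nat -> (j <= N)%nat -> Rabs (t - v0) < r ->
      continuous (fun t => B i j u t) t /\ Rabs (B i j u t) <= C).
    { intros u Hu i j t Hi Hj Ht; assert (Hb : box u0 v0 r (u, t)) by (split; auto).
      split; [|apply Hcoef; auto].
      apply (ex_derive_continuous (fun t => B i j u t)); exists (dv (B i j) u t).
      apply (smooth_partials D (B i j)); [apply Hsm; auto|auto]. }
    assert (Grow : forall (E : nat -> nat -> R -> R) (y : nat -> R -> R) a K,
      (forall i j t, (i <= N)%nat -> (j <= N)%nat -> Rabs (t - a) < r -> Rabs (E i j t) <= C) ->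
      (forall i, (i <= N)%nat -> Rabs (y i a) <= K) ->
      (forall i t, (i <= N)%nat -> Rabs (t - a) < r ->
         is_derive (y i) t (row_col N (fun j => E i j t) (fun j => y j t))) ->
      forall i t, (i <= N)%nat -> Rabs (t - a) < r -> Rabs (y i t) <= 2 * K).
    { intros E y a K HE Hya Hy i t Hi Ht.
      replace (2 * K) with (2 * (K + Rabs (t - a) * 0)) by ring.
      apply (short_time_estimate N E y (fun _ _ => 0) a (Rabs (t - a)) C);
        auto using Rabs_pos; try lra.
      - fold n; eapply Rle_trans; [|apply HnCr]; apply Rmult_le_compat_l; lra.
      - intros k j s Hk Hj Hs; apply HE; auto; lra.
      - intros; rewrite Rabs_R0; lra.
      - intros k s Hk Hs; rewrite Rplus_0_r; apply Hy; auto; lra. }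
    set (Y0 := picard_limit N (fun i j t => A i j t v0) u0 c).
    assert (Y0i : forall i, (i <= N)%nat -> Y0 i u0 = c i)
      by (intros; apply picard_limit_initial; auto).
    assert (Y0d : forall i t, (i <= N)%nat -> Rabs (t - u0) < r ->
      is_derive (Y0 i) t (row_col N (fun j => A i j t v0) (fun j => Y0 j t))).
    { intros i t Hi Ht.
      apply (picard_limit_solves N (fun i j t => A i j t v0) u0 r C M); auto. }
    assert (Y0b : forall i t, (i <= N)%nat -> Rabs (t - u0) < r -> Rabs (Y0 i t) <= 2 * M).
    { apply (Grow (fun i j t => A i j t v0)); auto.
      - intros i j t Hi Hj Ht; apply contA; auto.
      - intros i Hi; rewrite Y0i; auto. }
    set (Y := fun i u v => picard_limit N (fun i j t => B i j u t) v0 (fun i => Y0 i u) i v).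
    assert (Yi : forall i u, (i <= N)%nat -> Y i u v0 = Y0 i u)
      by (intros; apply picard_limit_initial; auto).
    assert (Yd : forall i u v, (i <= N)%nat -> box u0 v0 r (u, v) ->
      is_derive (fun t => Y i u t) v (row_col N (fun j => B i j u v) (fun j => Y j u v))).
    { intros i u v Hi [Hu Hv].
      apply (picard_limit_solves N (fun i j t => B i j u t) v0 r C (2 * M)); auto. }
    assert (Yb : forall i u v, (i <= N)%nat -> box u0 v0 r (u, v) ->
      Rabs (Y i u v) <= 2 * (2 * M)).
    { intros i u v Hi [Hu Hv].
      apply (Grow (fun i j t => B i j u t) (fun i t => Y i u t) v0); auto.
      - intros k j t Hk Hj Ht; apply contB; auto.
      - intros k Hk; rewrite Yi; auto.
      - intros k t Hk Ht; apply Yd; auto; split; auto. }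
    assert (Ysol : solves_pfaff N (box u0 v0 r) A B Y).
    { intros i Hi u v Huv; split; [|auto].
      apply (transverse_derivative N A B (fun i j => dv (A i j)) (fun i j => du (B i j))
        (fun i j => du (du (B i j))) Y u0 v0 r C (2 * (2 * M))); auto; try lra.
      - intros k j s t Hk Hj Hst; assert (HDst := HbD _ Hst).
        split; [apply Hcoef; auto|].
        destruct (Hsm k j Hk Hj) as [SA SB].
        split; [apply (smooth_partials D); auto|].
        split; [apply (smooth_partials D); auto|].
        split; [apply (smooth_partials D); auto using smooth_du|].
        apply Hint; auto.
      - intros k s Hk Hs.
        rewrite (row_col_ext N _ (fun j => A k j s v0) _ (fun j => Y0 j s)); auto.
        apply (is_derive_ext_loc (Y0 k)); [|auto].
        apply filter_forall; intros t; symmetry; apply Yi; auto. }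
    exists Y; split; [intros i Hi; rewrite Yi, Y0i; auto|]; split; [|exact Ysol].
    assert (SmAB : forall i j m, (i <= N)%nat -> (j <= N)%nat ->
      Cn (box u0 v0 r) m (A i j) /\ Cn (box u0 v0 r) m (B i j)).
    { intros i j m Hi Hj; destruct (Hsm i j Hi Hj) as [SA SB].
      split; apply smooth_Cn; apply (smooth_subset D); auto. }
    assert (SmY : forall m i, (i <= N)%nat -> Cn (box u0 v0 r) m (Y i)).
    { induction m as [|m IH]; intros i Hi.
      - apply Cn_0; intros u v Huv.
        destruct (open_locally_2d _ u v (open_box u0 v0 r) Huv) as [d Hd].
        eapply (continuity_of_bounded_partials (Y i) _ _ u v d (n * C * (2 * (2 * M)))).
        + apply cond_pos.
        + intros s t [Hs Ht]; apply (Ysol i Hi); apply Hd; auto.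
        + intros s t [Hs Ht]; specialize (Hd s t Hs Ht).
          split; apply row_col_bound; auto; intros j Hj; apply Hcoef; auto.
      - eapply (Cn_S_intro _ m (Y i)); [apply open_box|apply (Ysol i Hi)| |];
          apply Cn_row_col; auto using open_box; intros j Hj; apply SmAB; auto. }
    intros i Hi; apply smooth_Cn; intros m; apply SmY; auto.
  - intros Y Z Hyz HY HZ i u v Hi [Hu Hv]; simpl in Hu, Hv.
    assert (E0 : forall i u, (i <= N)%nat -> Rabs (u - u0) < r -> Y i u v0 = Z i u v0).
    { apply (short_time_unique N (fun i j t => A i j t v0)
        (fun i t => Y i t v0) (fun i t => Z i t v0) u0 r C); auto.
      - intros k j t Hk Hj Ht; apply Hcoef; auto.
      - intros k t Hk Ht; apply (HY k Hk); auto.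
      - intros k t Hk Ht; apply (HZ k Hk); auto. }
    apply (short_time_unique N (fun i j t => B i j u t)
        (fun i t => Y i u t) (fun i t => Z i u t) v0 r C); auto.
    + intros k j t Hk Hj Ht; apply Hcoef; auto; split; auto.
    + intros k t Hk Ht; apply (HY k Hk); split; auto.
    + intros k t Hk Ht; apply (HZ k Hk); split; auto.
Qed.

(** * Vectors and orthonormal frames of E^4 *)

(** Statements about vectors are proved for one coordinate function at a time. *)
Definition coord (c : E4 -> R) : Prop := c = c1 \/ c = c2 \/ c = c3 \/ c = c4.

Ltac each_coord H := destruct H as [-> | [-> | [-> | ->]]].

Lemma coord_ext p q : (forall c, coord c -> c p = c q) -> p = q.
Proof.
  intros H.
  pose proof (H c1 ltac:(unfold coord; auto)) as E1.
  pose proof (H c2 ltac:(unfold coord; auto)) as E2.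
  pose proof (H c3 ltac:(unfold coord; auto)) as E3.
  pose proof (H c4 ltac:(unfold coord; auto)) as E4'.
  destruct p as [[[p1 p2] p3] p4], q as [[[q1 q2] q3] q4].
  unfold c1, c2, c3, c4 in *; simpl in *; congruence.
Qed.

Lemma coord_plus c (p q : E4) : coord c -> c (plus p q) = c p + c q.
Proof. intros H; each_coord H; reflexivity. Qed.

Lemma coord_minus c (p q : E4) : coord c -> c (minus p q) = c p - c q.
Proof. intros H; each_coord H; reflexivity. Qed.

Lemma coord_scal c a (p : E4) : coord c -> c (scal a p) = a * c p.
Proof. intros H; each_coord H; reflexivity. Qed.

Lemma coord_zero c : coord c -> c (zero : E4) = 0.
Proof. intros H; each_coord H; reflexivity. Qed.

Lemma coord_duE c w u v : coord c -> c (duE w u v) = du (fun s t => c (w s t)) u v.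
Proof. intros H; each_coord H; reflexivity. Qed.

Lemma coord_dvE c w u v : coord c -> c (dvE w u v) = dv (fun s t => c (w s t)) u v.
Proof. intros H; each_coord H; reflexivity. Qed.

Lemma smoothE_coord (D : R * R -> Prop) w :
  smoothE D w <-> forall c, coord c -> smooth D (fun u v => c (w u v)).
Proof.
  split.
  - intros (H1 & H2 & H3 & H4) c H; each_coord H; auto.
  - intros H; unfold smoothE; repeat split; apply H; unfold coord; auto.
Qed.

Lemma dot_sym p q : dot p q = dot q p.
Proof. unfold dot; ring. Qed.

Lemma dot_plus_l (p q w : E4) : dot (plus p q) w = dot p w + dot q w.
Proof. unfold dot; rewrite !coord_plus by (unfold coord; auto); ring. Qed.

Lemma dot_minus_l (p q w : E4) : dot (minus p q) w = dot p w - dot q w.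
Proof. unfold dot; rewrite !coord_minus by (unfold coord; auto); ring. Qed.

Lemma dot_scal_l a (p w : E4) : dot (scal a p) w = a * dot p w.
Proof. unfold dot; rewrite !coord_scal by (unfold coord; auto); ring. Qed.

Lemma dot_zero_l (w : E4) : dot (zero : E4) w = 0.
Proof. unfold dot; rewrite !coord_zero by (unfold coord; auto); ring. Qed.

Definition comb (x y b l : E4) (a1 a2 a3 a4 : R) : E4 :=
  plus (plus (scal a1 x) (scal a2 y)) (plus (scal a3 b) (scal a4 l)).

Lemma coord_comb c x y b l a1 a2 a3 a4 : coord c ->
  c (comb x y b l a1 a2 a3 a4) = a1 * c x + a2 * c y + a3 * c b + a4 * c l.
Proof. intros H; unfold comb; rewrite !coord_plus, !coord_scal by auto; ring. Qed.

Lemma dot_comb_l x y b l a1 a2 a3 a4 w :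
  dot (comb x y b l a1 a2 a3 a4) w
  = a1 * dot x w + a2 * dot y w + a3 * dot b w + a4 * dot l w.
Proof. unfold comb; rewrite !dot_plus_l, !dot_scal_l; ring. Qed.

(** A square matrix [M] with [M M^T = I] has [M^T M = I], because [M M^T - I]
    and [M^T M - I] have the same sum of squared entries. *)
Lemma orthonormal_transpose x y b l : orthonormal x y b l ->
  orthonormal (c1 x, c1 y, c1 b, c1 l) (c2 x, c2 y, c2 b, c2 l)
              (c3 x, c3 y, c3 b, c3 l) (c4 x, c4 y, c4 b, c4 l).
Proof.
  intros ((Hxx & Hyy & Hbb & Hll) & Hxy & Hxb & Hxl & Hyb & Hyl & Hbl).
  set (t1 := (c1 x, c1 y, c1 b, c1 l) : E4); set (t2 := (c2 x, c2 y, c2 b, c2 l) : E4).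
  set (t3 := (c3 x, c3 y, c3 b, c3 l) : E4); set (t4 := (c4 x, c4 y, c4 b, c4 l) : E4).
  assert (Frob :
    (dot t1 t1 - 1) ^ 2 + (dot t2 t2 - 1) ^ 2 + (dot t3 t3 - 1) ^ 2 + (dot t4 t4 - 1) ^ 2
    + 2 * (dot t1 t2 ^ 2 + dot t1 t3 ^ 2 + dot t1 t4 ^ 2 + dot t2 t3 ^ 2
           + dot t2 t4 ^ 2 + dot t3 t4 ^ 2)
    = (dot x x - 1) ^ 2 + (dot y y - 1) ^ 2 + (dot b b - 1) ^ 2 + (dot l l - 1) ^ 2
    + 2 * (dot x y ^ 2 + dot x b ^ 2 + dot x l ^ 2 + dot y b ^ 2
           + dot y l ^ 2 + dot b l ^ 2)).
  { unfold t1, t2, t3, t4, dot.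
    destruct x as [[[x1 x2] x3] x4], y as [[[y1 y2] y3] y4],
      b as [[[b1 b2] b3] b4], l as [[[l1 l2] l3] l4].
    unfold c1, c2, c3, c4; simpl fst; simpl snd; ring. }
  rewrite Hxx, Hyy, Hbb, Hll, Hxy, Hxb, Hxl, Hyb, Hyl, Hbl in Frob.
  assert (Z : forall r : R, r ^ 2 <= 0 -> r = 0)
    by (intros r Hr; apply Rsqr_0_uniq; unfold Rsqr; nra).
  pose proof (pow2_ge_0 (dot t1 t1 - 1)); pose proof (pow2_ge_0 (dot t2 t2 - 1)).
  pose proof (pow2_ge_0 (dot t3 t3 - 1)); pose proof (pow2_ge_0 (dot t4 t4 - 1)).
  pose proof (pow2_ge_0 (dot t1 t2)); pose proof (pow2_ge_0 (dot t1 t3)).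
  pose proof (pow2_ge_0 (dot t1 t4)); pose proof (pow2_ge_0 (dot t2 t3)).
  pose proof (pow2_ge_0 (dot t2 t4)); pose proof (pow2_ge_0 (dot t3 t4)).
  assert (Z1 : forall r : R, (r - 1) ^ 2 <= 0 -> r = 1)
    by (intros r Hr; apply Z in Hr; lra).
  split; [split; [|split; [|split]]; apply Z1
         |split; [|split; [|split; [|split; [|split]]]]; apply Z]; lra.
Qed.

(** The coordinates of the expansion are those of [M^T M w]. *)
Lemma orthonormal_expand x y b l w : orthonormal x y b l ->
  w = comb x y b l (dot w x) (dot w y) (dot w b) (dot w l).
Proof.
  intros H; apply orthonormal_transpose in H.
  destruct H as ((H11 & H22 & H33 & H44) & H12 & H13 & H14 & H23 & H24 & H34).
  set (t1 := (c1 x, c1 y, c1 b, c1 l) : E4) in *.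
  set (t2 := (c2 x, c2 y, c2 b, c2 l) : E4) in *.
  set (t3 := (c3 x, c3 y, c3 b, c3 l) : E4) in *.
  set (t4 := (c4 x, c4 y, c4 b, c4 l) : E4) in *.
  apply coord_ext; intros c Hc; rewrite coord_comb by auto.
  set (t := (c x, c y, c b, c l) : E4).
  assert (E : dot w x * c x + dot w y * c y + dot w b * c b + dot w l * c l
    = c1 w * dot t1 t + c2 w * dot t2 t + c3 w * dot t3 t + c4 w * dot t4 t).
  { unfold t1, t2, t3, t4, t, dot; cbv [c1 c2 c3 c4 fst snd]; ring. }
  rewrite E; each_coord Hc; fold t1 t2 t3 t4 in t; unfold t;
    rewrite ?(dot_sym t2 t1), ?(dot_sym t3 t1), ?(dot_sym t4 t1), ?(dot_sym t3 t2),
      ?(dot_sym t4 t2), ?(dot_sym t4 t3), ?H11, ?H22, ?H33, ?H44, ?H12, ?H13, ?H14,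
      ?H23, ?H24, ?H34; ring.
Qed.

(** * Vector fields along a parametrized surface *)

Definition has_partialsE (D : R * R -> Prop) (w P Q : R -> R -> E4) : Prop :=
  forall c, coord c -> has_partials D (fun u v => c (w u v))
    (fun u v => c (P u v)) (fun u v => c (Q u v)).

Lemma has_partialsE_duE (D : R * R -> Prop) w P Q u v :
  has_partialsE D w P Q -> D (u, v) -> duE w u v = P u v.
Proof.
  intros H Huv; apply coord_ext; intros c Hc; rewrite coord_duE by auto.
  apply (has_partials_du D _ _ _ u v (H c Hc) Huv).
Qed.

Lemma has_partialsE_dvE (D : R * R -> Prop) w P Q u v :
  has_partialsE D w P Q -> D (u, v) -> dvE w u v = Q u v.
Proof.
  intros H Huv; apply coord_ext; intros c Hc; rewrite coord_dvE by auto.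
  apply (has_partials_dv D _ _ _ u v (H c Hc) Huv).
Qed.

Lemma has_partialsE_ext (D : R * R -> Prop) w P Q w' P' Q' : open D ->
  (forall u v, D (u, v) -> w u v = w' u v) ->
  (forall u v, D (u, v) -> P u v = P' u v) ->
  (forall u v, D (u, v) -> Q u v = Q' u v) ->
  has_partialsE D w P Q -> has_partialsE D w' P' Q'.
Proof.
  intros HO E1 E2 E3 H c Hc; eapply has_partials_ext; [auto| | | |apply (H c Hc)];
    simpl; intros u v Huv; f_equal; auto.
Qed.

Lemma smoothE_partials (D : R * R -> Prop) w :
  smoothE D w -> has_partialsE D w (duE w) (dvE w).
Proof.
  intros H c Hc u v Huv; rewrite coord_duE, coord_dvE by auto.
  apply (smooth_partials D (fun u v => c (w u v))); auto.
  now apply smoothE_coord.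
Qed.

Lemma smoothE_duE (D : R * R -> Prop) w : smoothE D w -> smoothE D (duE w).
Proof. intros (H1 & H2 & H3 & H4); repeat split; now apply smooth_du. Qed.

Lemma smoothE_dvE (D : R * R -> Prop) w : smoothE D w -> smoothE D (dvE w).
Proof. intros (H1 & H2 & H3 & H4); repeat split; now apply smooth_dv. Qed.

Lemma smoothE_ext (D : R * R -> Prop) w w' : open D ->
  (forall u v, D (u, v) -> w u v = w' u v) -> smoothE D w -> smoothE D w'.
Proof.
  intros HO E; rewrite !smoothE_coord; intros H c Hc.
  apply (smooth_ext D HO (fun u v => c (w u v))); auto.
  intros u v Huv; f_equal; auto.
Qed.

Lemma smoothE_scal (D : R * R -> Prop) f w : open D ->
  smooth D f -> smoothE D w -> smoothE D (fun u v => scal (f u v) (w u v)).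
Proof.
  intros HO Hf; rewrite !smoothE_coord; intros Hw c Hc.
  apply (smooth_ext D HO (fun u v => f u v * c (w u v))).
  - intros; now rewrite coord_scal.
  - apply smooth_mult; auto.
Qed.

Lemma has_partialsE_scal (D : R * R -> Prop) f fu fv w P Q :
  has_partials D f fu fv -> has_partialsE D w P Q ->
  has_partialsE D (fun u v => scal (f u v) (w u v))
    (fun u v => plus (scal (fu u v) (w u v)) (scal (f u v) (P u v)))
    (fun u v => plus (scal (fv u v) (w u v)) (scal (f u v) (Q u v))).
Proof.
  intros Hf Hw c Hc u v Huv.
  destruct (has_partials_mult D _ _ _ _ _ _ Hf (Hw c Hc) u v Huv) as [H1 H2].
  rewrite !coord_plus, !coord_scal by auto; split.
  - apply (is_derive_ext (fun s => f s v * c (w s v))); auto.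
    intros; now rewrite coord_scal.
  - apply (is_derive_ext (fun t => f u t * c (w u t))); auto.
    intros; now rewrite coord_scal.
Qed.

Lemma has_partials_dot (D : R * R -> Prop) a b P Q P' Q' :
  has_partialsE D a P Q -> has_partialsE D b P' Q' ->
  has_partials D (fun u v => dot (a u v) (b u v))
    (fun u v => dot (P u v) (b u v) + dot (a u v) (P' u v))
    (fun u v => dot (Q u v) (b u v) + dot (a u v) (Q' u v)).
Proof.
  intros Ha Hb u v Huv.
  assert (G : forall c, coord c ->
     has_partials D (fun u v => c (a u v) * c (b u v)) _ _)
    by (intros c Hc; exact (has_partials_mult D _ _ _ _ _ _ (Ha c Hc) (Hb c Hc))).
  pose proof (has_partials_plus D _ _ _ _ _ _ (has_partials_plus D _ _ _ _ _ _
    (has_partials_plus D _ _ _ _ _ _ (G c1 ltac:(unfold coord; auto))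
       (G c2 ltac:(unfold coord; auto))) (G c3 ltac:(unfold coord; auto)))
    (G c4 ltac:(unfold coord; auto)) u v Huv) as [H1 H2].
  split; (eapply is_derive_value; [eassumption|unfold dot; simpl; ring]).
Qed.

Lemma smooth_dot (D : R * R -> Prop) a b : open D -> smoothE D a -> smoothE D b ->
  smooth D (fun u v => dot (a u v) (b u v)).
Proof.
  intros HO (A1 & A2 & A3 & A4) (B1 & B2 & B3 & B4); unfold dot.
  repeat apply smooth_plus; auto; apply smooth_mult; auto.
Qed.

(** Source of the skewness of the derivatives of an orthonormal frame. *)
Lemma dot_constant (D : R * R -> Prop) a b k u v : open D -> smoothE D a -> smoothE D b ->
  (forall u v, D (u, v) -> dot (a u v) (b u v) = k) -> D (u, v) ->
  dot (duE a u v) (b u v) + dot (duE b u v) (a u v) = 0 /\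
  dot (dvE a u v) (b u v) + dot (dvE b u v) (a u v) = 0.
Proof.
  intros HO Ha Hb Hk Huv.
  pose proof (has_partials_dot D _ _ _ _ _ _ (smoothE_partials D a Ha)
                (smoothE_partials D b Hb)) as H.
  pose proof (has_partials_ext D _ (fun _ _ => k) _ _ _ _ HO Hk
                (fun u v _ => eq_refl) (fun u v _ => eq_refl) H) as H'.
  pose proof (has_partials_const D k) as Hc.
  rewrite (dot_sym (duE b u v)), (dot_sym (dvE b u v)); split.
  - rewrite <- (has_partials_du D _ _ _ u v H' Huv).
    apply (has_partials_du D _ _ _ u v Hc Huv).
  - rewrite <- (has_partials_dv D _ _ _ u v H' Huv).
    apply (has_partials_dv D _ _ _ u v Hc Huv).
Qed.

Lemma dot_normal z u v w n :
  dot n (duE z u v) = 0 -> dot n (dvE z u v) = 0 ->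
  dot (normal z u v w) n = dot w n.
Proof.
  intros H1 H2; unfold normal, tangential.
  rewrite dot_minus_l, dot_plus_l, !dot_scal_l.
  rewrite (dot_sym (duE z u v)), (dot_sym (dvE z u v)), H1, H2; ring.
Qed.

Lemma normal_comb z u v f x y b l a1 a2 a3 a4 :
  duE z u v = scal f x -> dvE z u v = scal f y -> f <> 0 -> orthonormal x y b l ->
  normal z u v (comb x y b l a1 a2 a3 a4) = comb x y b l 0 0 a3 a4.
Proof.
  intros Hu Hv Hf ((Hxx & Hyy & Hbb & Hll) & Hxy & Hxb & Hxl & Hyb & Hyl & Hbl).
  apply coord_ext; intros c Hc; unfold normal, tangential, ffE, ffF, ffG.
  rewrite coord_minus, coord_plus, !coord_scal, !coord_comb, Hu, Hv by auto.
  rewrite !dot_scal_l, !(dot_sym _ (scal f _)), !dot_scal_l.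
  rewrite !(dot_sym _ (comb _ _ _ _ _ _ _ _)), !dot_comb_l, !coord_scal by auto.
  rewrite (dot_sym y x), (dot_sym b x), (dot_sym l x), (dot_sym b y), (dot_sym l y).
  rewrite Hxx, Hyy, Hxy, Hxb, Hxl, Hyb, Hyl; field; auto.
Qed.

(** * The frame equations in canonical parameters *)

(** The square root of [E = G = 1 / |mu|], written as an exponential because its
    logarithmic derivatives are the coefficients [- p], [- q]. *)
Definition conformal (mu : R -> R -> R) : R -> R -> R :=
  fun u v => exp (- ln_abs mu u v / 2).

Definition half_du (w : R -> R -> R) : R -> R -> R := fun u v => du w u v / 2.
Definition half_dv (w : R -> R -> R) : R -> R -> R := fun u v => dv w u v / 2.
Definition times (f g : R -> R -> R) : R -> R -> R := fun u v => f u v * g u v.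

Section Coefficients.
Variables (D : R * R -> Prop) (lam mu nu : R -> R -> R).
Hypothesis HO : open D.
Hypothesis Hlam : smooth D lam.
Hypothesis Hmu : smooth D mu.
Hypothesis Hnu : smooth D nu.
Hypothesis Hmu0 : forall u v, D (u, v) -> mu u v <> 0.

Let w := ln_abs mu.
Let phi := conformal mu.
Let p := half_du w.
Let q := half_dv w.

Lemma ln_abs_partials : has_partials D w
  (fun u v => / mu u v * du mu u v) (fun u v => / mu u v * dv mu u v).
Proof.
  apply (has_partials_comp D (fun x => ln (Rabs x)) Rinv).
  - intros u v Huv; specialize (Hmu0 u v Huv).
    assert (Habs : 0 < Rabs (mu u v)) by now apply Rabs_pos_lt.
    apply (is_derive_value _ _ (/ Rabs (mu u v) * (sign (mu u v) * 1))).
    + apply (is_derive_Rcomp ln Rabs); [now apply is_derive_ln|].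
      apply (is_derive_Rabs (fun x => x)); [apply (is_derive_id (mu u v))|auto].
    + destruct (Rtotal_order (mu u v) 0) as [Hlt|[He|Hgt]]; [|contradiction|].
      * rewrite sign_eq_m1, Rabs_left by auto; field; auto.
      * rewrite sign_eq_1, Rabs_right by lra; field; auto.
  - now apply smooth_partials.
Qed.

Lemma smooth_ln_abs : smooth D w.
Proof.
  eapply smooth_intro; [auto|apply ln_abs_partials| |];
    apply smooth_mult; auto using smooth_inv, smooth_du, smooth_dv.
Qed.

Lemma smooth_half_du : smooth D p.
Proof. apply smooth_mult; auto using smooth_const, smooth_du, smooth_ln_abs. Qed.

Lemma smooth_half_dv : smooth D q.
Proof. apply smooth_mult; auto using smooth_const, smooth_dv, smooth_ln_abs. Qed.

Lemma mu_partials : has_partials D mu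
  (fun u v => 2 * p u v * mu u v) (fun u v => 2 * q u v * mu u v).
Proof.
  apply (has_partials_ext D mu mu (du mu) (dv mu)); auto using smooth_partials.
  - intros u v Huv; unfold p, half_du.
    rewrite (has_partials_du D w _ _ u v ln_abs_partials Huv); field; auto.
  - intros u v Huv; unfold q, half_dv.
    rewrite (has_partials_dv D w _ _ u v ln_abs_partials Huv); field; auto.
Qed.

Lemma conformal_partials : has_partials D phi
  (fun u v => - p u v * phi u v) (fun u v => - q u v * phi u v).
Proof.
  pose proof (has_partials_comp D (fun x => exp (- x / 2))
    (fun x => - / 2 * exp (- x / 2)) w (du w) (dv w)) as H.
  eapply has_partials_ext; [auto|reflexivity| | |apply H].
  - intros; simpl; unfold phi, conformal, p, half_du; fold w; field.
  - intros; simpl; unfold phi, conformal, q, half_dv; fold w; field.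
  - intros u v Huv; auto_derive; [auto|]; unfold Rdiv; ring.
  - apply smooth_partials, smooth_ln_abs.
Qed.

Lemma conformal_pos u v : 0 < phi u v.
Proof. apply exp_pos. Qed.

Lemma conformal_sqr u v : D (u, v) -> phi u v * phi u v = 1 / Rabs (mu u v).
Proof.
  intros Huv; unfold phi, conformal; rewrite <- exp_plus.
  replace (- ln_abs mu u v / 2 + - ln_abs mu u v / 2) with (- ln_abs mu u v) by field.
  rewrite exp_Ropp; unfold ln_abs; rewrite exp_ln; [field|]; try apply Rabs_no_R0;
    try apply Rabs_pos_lt; auto.
Qed.

Lemma smooth_conformal : smooth D phi.
Proof.
  assert (H : forall n, Cn D n phi).
  { induction n as [|n IH].
    - apply Cn_0; intros u v Huv.
      apply (continuity_1d_2d_pt_comp (fun x => exp (- x / 2)) w).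
      + apply continuity_pt_filterlim, (ex_derive_continuous (fun x => exp (- x / 2))).
        auto_derive; auto.
      + apply (smooth_continuity D); auto using smooth_ln_abs.
    - eapply Cn_S_intro; [auto|apply conformal_partials| |];
        apply Cn_mult; auto; apply smooth_Cn, smooth_opp;
        auto using smooth_half_du, smooth_half_dv. }
  now apply smooth_Cn.
Qed.

End Coefficients.

(** Entries of the derivation matrices of the moving quintuple
    [(x, y, b, l, z)], the position vector [z] being carried along with the
    frame so that a single linear system yields the surface as well. *)
Definition frame_mx_u (p q f al be ga : R -> R -> R) (i j : nat) : R -> R -> R :=
  match i, j with
  | 0%nat, 1%nat => q | 0%nat, 2%nat => al
  | 1%nat, 0%nat => (fun u v => - q u v) | 1%nat, 2%nat => be | 1%nat, 3%nat => ga
  | 2%nat, 0%nat => (fun u v => - al u v) | 2%nat, 1%nat => (fun u v => - be u v)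
  | 3%nat, 1%nat => (fun u v => - ga u v)
  | 4%nat, 0%nat => f
  | _, _ => (fun _ _ => 0)
  end.

Definition frame_mx_v (p q f al be ga : R -> R -> R) (i j : nat) : R -> R -> R :=
  match i, j with
  | 0%nat, 1%nat => (fun u v => - p u v) | 0%nat, 2%nat => be | 0%nat, 3%nat => ga
  | 1%nat, 0%nat => p | 1%nat, 2%nat => al
  | 2%nat, 0%nat => (fun u v => - be u v) | 2%nat, 1%nat => (fun u v => - al u v)
  | 3%nat, 0%nat => (fun u v => - ga u v)
  | 4%nat, 1%nat => f
  | _, _ => (fun _ _ => 0)
  end.

Lemma du_opp f u v : du (fun s t => - f s t) u v = - du f u v.
Proof. exact (Derive_opp _ _). Qed.

Lemma dv_opp f u v : dv (fun s t => - f s t) u v = - dv f u v.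
Proof. exact (Derive_opp _ _). Qed.

Lemma du_0 u v : du (fun _ _ => 0) u v = 0.
Proof. exact (Derive_const 0 _). Qed.

Lemma dv_0 u v : dv (fun _ _ => 0) u v = 0.
Proof. exact (Derive_const 0 _). Qed.

Lemma le_4_cases i : (i <= 4)%nat ->
  (i = 0 \/ i = 1 \/ i = 2 \/ i = 3 \/ i = 4)%nat.
Proof. lia. Qed.

Ltac index_cases i H :=
  apply le_4_cases in H; destruct H as [-> | [-> | [-> | [-> | ->]]]].

Section Integrability.
Variables (D : R * R -> Prop) (lam mu nu : R -> R -> R).
Hypothesis HO : open D.
Hypothesis Hlam : smooth D lam.
Hypothesis Hmu : smooth D mu.
Hypothesis Hnu : smooth D nu.
Hypothesis Hmu0 : forall u v, D (u, v) -> mu u v <> 0.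
Hypothesis Hnu_u : forall u v, D (u, v) ->
  du nu u v = dv lam u v - lam u v * dv (ln_abs mu) u v.
Hypothesis Hnu_v : forall u v, D (u, v) ->
  dv nu u v = du lam u v - lam u v * du (ln_abs mu) u v.
Hypothesis Hgauss : forall u v, D (u, v) ->
  nu u v ^ 2 - (lam u v ^ 2 + mu u v ^ 2)
    = 1 / 2 * Rabs (mu u v) * laplacian (ln_abs mu) u v.

Let phi := conformal mu.
Let p := half_du (ln_abs mu).
Let q := half_dv (ln_abs mu).
Let A := frame_mx_u p q phi (times phi nu) (times phi lam) (times phi mu).
Let B := frame_mx_v p q phi (times phi nu) (times phi lam) (times phi mu).

Lemma frame_mx_smooth i j : smooth D (A i j) /\ smooth D (B i j).
Proof.
  assert (Sp : smooth D p) by now apply smooth_half_du.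
  assert (Sq : smooth D q) by now apply smooth_half_dv.
  assert (Sf : smooth D phi) by now apply smooth_conformal.
  assert (Sal : smooth D (times phi nu)) by now apply smooth_mult.
  assert (Sbe : smooth D (times phi lam)) by now apply smooth_mult.
  assert (Sga : smooth D (times phi mu)) by now apply smooth_mult.
  split; unfold A, B, frame_mx_u, frame_mx_v;
    repeat match goal with |- context [match ?k with _ => _ end] => destruct k end;
    auto using smooth_opp, smooth_const.
Qed.

(** The [(x, y)] entry of the integrability condition is the Gauss equation, the
    [(x, b)] and [(y, b)] entries are the Codazzi equations, and the remaining
    ones hold identically. *)
Lemma frame_mx_integrable i j u v : (i <= 4)%nat -> (j <= 4)%nat -> D (u, v) ->
  dv (A i j) u v + row_col 4 (fun k => A i k u v) (fun k => B k j u v)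
  = du (B i j) u v + row_col 4 (fun k => B i k u v) (fun k => A k j u v).
Proof.
  intros Hi Hj Huv.
  pose proof (conformal_partials D mu HO Hmu Hmu0) as Pf; fold phi p q in Pf.
  pose proof (mu_partials D mu HO Hmu Hmu0) as Pm; fold p q in Pm.
  pose proof (smooth_partials D nu Hnu) as Pn.
  pose proof (smooth_partials D lam Hlam) as Pl.
  pose proof (has_partials_mult D _ _ _ _ _ _ Pf Pm) as Pga.
  pose proof (has_partials_mult D _ _ _ _ _ _ Pf Pn) as Pal.
  pose proof (has_partials_mult D _ _ _ _ _ _ Pf Pl) as Pbe.
  assert (Nu : du nu u v = dv lam u v - lam u v * (2 * q u v))
    by (rewrite (Hnu_u u v Huv); unfold q, half_dv; field).
  assert (Nv : dv nu u v = du lam u v - lam u v * (2 * p u v))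
    by (rewrite (Hnu_v u v Huv); unfold p, half_du; field).
  assert (Ga : du p u v + dv q u v
    = phi u v * phi u v * (nu u v ^ 2 - (lam u v ^ 2 + mu u v ^ 2))).
  { rewrite (Hgauss u v Huv); unfold phi; rewrite (conformal_sqr D) by auto.
    unfold laplacian.
    assert (Ep : du p u v = du (du (ln_abs mu)) u v / 2).
    { unfold p, half_du, du at 1, Rdiv; rewrite Derive_scal_l; reflexivity. }
    assert (Eq : dv q u v = dv (dv (ln_abs mu)) u v / 2).
    { unfold q, half_dv, dv at 1, Rdiv; rewrite Derive_scal_l; reflexivity. }
    rewrite Ep, Eq; field; apply Rabs_no_R0; auto. }
  index_cases i Hi; index_cases j Hj; cbv beta delta [row_col]; simpl sum_f_R0;
    unfold A, B, frame_mx_u, frame_mx_v;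
    rewrite ?du_opp, ?dv_opp, ?du_0, ?dv_0;
    unfold times;
    rewrite ?(has_partials_du D _ _ _ u v Pf Huv), ?(has_partials_dv D _ _ _ u v Pf Huv),
      ?(has_partials_du D _ _ _ u v Pal Huv), ?(has_partials_dv D _ _ _ u v Pal Huv),
      ?(has_partials_du D _ _ _ u v Pbe Huv), ?(has_partials_dv D _ _ _ u v Pbe Huv),
      ?(has_partials_du D _ _ _ u v Pga Huv), ?(has_partials_dv D _ _ _ u v Pga Huv),
      ?Nu, ?Nv; try ring; nra.
Qed.

End Integrability.

(** The vectorial form of the Pfaffian system displayed at the top. *)
Definition frame_equations (D : R * R -> Prop) (p q f al be ga : R -> R -> R)
    (x y b l z : R -> R -> E4) : Prop :=
  let fr a1 a2 a3 a4 := fun u v => comb (x u v) (y u v) (b u v) (l u v)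
    (a1 u v) (a2 u v) (a3 u v) (a4 u v) in
  let o := fun _ _ => 0 in
  let neg (g : R -> R -> R) := fun u v => - g u v in
  has_partialsE D x (fr o q al o) (fr o (neg p) be ga) /\
  has_partialsE D y (fr (neg q) o be ga) (fr p o al o) /\
  has_partialsE D b (fr (neg al) (neg be) o o) (fr (neg be) (neg al) o o) /\
  has_partialsE D l (fr o (neg ga) o o) (fr (neg ga) o o o) /\
  has_partialsE D z (fr f o o o) (fr o f o o).

Definition stack (c : E4 -> R) (x y b l z : R -> R -> E4) (i : nat) : R -> R -> R :=
  fun u v => c (match i with
                | 0%nat => x u v | 1%nat => y u v | 2%nat => b u v
                | 3%nat => l u v | _ => z u v
                end).

Lemma frame_equations_pfaff (D : R * R -> Prop) p q f al be ga x y b l z : open D ->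
  frame_equations D p q f al be ga x y b l z <->
  forall c, coord c -> solves_pfaff 4 D (frame_mx_u p q f al be ga)
    (frame_mx_v p q f al be ga) (stack c x y b l z).
Proof.
  intros HO; split.
  - intros (Hx & Hy & Hb & Hl & Hz) c Hc i Hi.
    index_cases i Hi; unfold stack;
      [specialize (Hx c Hc)|specialize (Hy c Hc)|specialize (Hb c Hc)
      |specialize (Hl c Hc)|specialize (Hz c Hc)];
      (eapply has_partials_ext; [exact HO| | | |eassumption]);
      intros u v _; simpl; rewrite ?coord_comb by auto;
      unfold row_col; simpl; ring.
  - intros H; refine (conj _ (conj _ (conj _ (conj _ _)))); intros c Hc;
      specialize (H c Hc);
      [specialize (H 0%nat)|specialize (H 1%nat)|specialize (H 2%nat)
      |specialize (H 3%nat)|specialize (H 4%nat)];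
      (eapply has_partials_ext; [exact HO| | | |apply H; lia]);
      intros u v _; simpl; rewrite ?coord_comb by auto;
      unfold row_col, stack; simpl; ring.
Qed.

(** * From the frame equations to the surface *)

Section FrameToSurface.
Variables (D : R * R -> Prop) (lam mu nu p q phi : R -> R -> R).
Variables (x y b l z : R -> R -> E4).
Hypothesis HO : open D.
Hypothesis Hphi : has_partials D phi (fun u v => - p u v * phi u v)
                                     (fun u v => - q u v * phi u v).
Hypothesis Hpos : forall u v, 0 < phi u v.
Hypothesis Hsqr : forall u v, D (u, v) -> phi u v * phi u v = 1 / Rabs (mu u v).
Hypothesis Hnu0 : forall u v, D (u, v) -> nu u v <> 0.
Hypothesis Hb : smoothE D b.
Hypothesis Hl : smoothE D l.
Hypothesis Hz : smoothE D z.
Hypothesis Hon : forall u v, D (u, v) -> orthonormal (x u v) (y u v) (b u v) (l u v).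
Hypothesis Hfr : frame_equations D p q phi (times phi nu) (times phi lam)
                   (times phi mu) x y b l z.

Lemma built_duE u v : D (u, v) -> duE z u v = scal (phi u v) (x u v).
Proof.
  intros Huv; destruct Hfr as (_ & _ & _ & _ & Fz).
  rewrite (has_partialsE_duE D z _ _ u v Fz Huv).
  apply coord_ext; intros c Hc; rewrite coord_comb, coord_scal by auto; ring.
Qed.

Lemma built_dvE u v : D (u, v) -> dvE z u v = scal (phi u v) (y u v).
Proof.
  intros Huv; destruct Hfr as (_ & _ & _ & _ & Fz).
  rewrite (has_partialsE_dvE D z _ _ u v Fz Huv).
  apply coord_ext; intros c Hc; rewrite coord_comb, coord_scal by auto; ring.
Qed.

Lemma built_first_form u v : D (u, v) ->
  ffE z u v = phi u v * phi u v /\ ffG z u v = phi u v * phi u v /\ ffF z u v = 0.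
Proof.
  intros Huv; destruct (Hon u v Huv) as ((Hxx & Hyy & _ & _) & Hxy & _).
  unfold ffE, ffG, ffF; rewrite built_duE, built_dvE by auto.
  rewrite !dot_scal_l, !(dot_sym _ (scal _ _)), !dot_scal_l.
  rewrite ?(dot_sym (y u v) (x u v)), Hxx, Hyy, Hxy; repeat split; ring.
Qed.

Lemma built_sqrtE u v : D (u, v) ->
  sqrt (ffE z u v) = phi u v /\ sqrt (ffG z u v) = phi u v.
Proof.
  intros Huv; destruct (built_first_form u v Huv) as (-> & -> & _).
  specialize (Hpos u v); split; apply sqrt_square; lra.
Qed.

Lemma built_push_x u v : D (u, v) -> push z (frame_x z) u v = x u v.
Proof.
  intros Huv; unfold push, frame_x; simpl.
  rewrite (proj1 (built_sqrtE u v Huv)), built_duE, built_dvE by auto.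
  apply coord_ext; intros c Hc; rewrite coord_plus, !coord_scal by auto.
  field; apply Rgt_not_eq, Hpos.
Qed.

Lemma built_push_y u v : D (u, v) -> push z (frame_y z) u v = y u v.
Proof.
  intros Huv; unfold push, frame_y; simpl.
  rewrite (proj2 (built_sqrtE u v Huv)), built_duE, built_dvE by auto.
  apply coord_ext; intros c Hc; rewrite coord_plus, !coord_scal by auto.
  field; apply Rgt_not_eq, Hpos.
Qed.

Lemma built_normal_flat X w u v a1 a2 a3 a4 a1' a2' a3' a4' : D (u, v) ->
  duE w u v = comb (x u v) (y u v) (b u v) (l u v) a1 a2 a3 a4 ->
  dvE w u v = comb (x u v) (y u v) (b u v) (l u v) a1' a2' a3' a4' ->
  normal z u v (flat X w u v)
  = plus (scal (fst (X u v) * a3 + snd (X u v) * a3') (b u v))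
         (scal (fst (X u v) * a4 + snd (X u v) * a4') (l u v)).
Proof.
  intros Huv E1 E2; unfold flat; rewrite E1, E2.
  set (s := fst (X u v)); set (t := snd (X u v)).
  replace (plus (scal s _) (scal t _)) with
    (comb (x u v) (y u v) (b u v) (l u v) (s * a1 + t * a1') (s * a2 + t * a2')
       (s * a3 + t * a3') (s * a4 + t * a4')).
  - rewrite (normal_comb z u v (phi u v)); auto using built_duE, built_dvE.
    + apply coord_ext; intros c Hc.
      rewrite coord_comb, coord_plus, !coord_scal by auto; ring.
    + apply Rgt_not_eq, Hpos.
  - apply coord_ext; intros c Hc.
    rewrite coord_plus, !coord_scal, !coord_comb by auto; ring.
Qed.

(** The trace is taken with [z_u = phi x] and [z_v = phi y], whose second
    derivatives have the same normal component [phi^2 nu b]. *)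
Lemma built_mean_curvature u v : D (u, v) ->
  mean_curvature z u v = scal (nu u v) (b u v).
Proof.
  intros Huv; pose proof Hfr as (Fx & Fy & _ & _ & _).
  assert (Ecu : forall s t, D (s, t) ->
    scal (phi s t) (x s t) = push z coord_u s t).
  { intros s t Hst; unfold push, coord_u; simpl; rewrite built_duE, built_dvE by auto.
    apply coord_ext; intros c Hc; rewrite coord_plus, !coord_scal by auto; ring. }
  assert (Ecv : forall s t, D (s, t) ->
    scal (phi s t) (y s t) = push z coord_v s t).
  { intros s t Hst; unfold push, coord_v; simpl; rewrite built_duE, built_dvE by auto.
    apply coord_ext; intros c Hc; rewrite coord_plus, !coord_scal by auto; ring. }
  assert (Pu := has_partialsE_ext D _ _ _ _ _ _ HO Ecu (fun u v _ => eq_refl)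
    (fun u v _ => eq_refl) (has_partialsE_scal D _ _ _ _ _ _ Hphi Fx)).
  assert (Pv := has_partialsE_ext D _ _ _ _ _ _ HO Ecv (fun u v _ => eq_refl)
    (fun u v _ => eq_refl) (has_partialsE_scal D _ _ _ _ _ _ Hphi Fy)).
  set (f := phi u v); set (n := nu u v).
  set (fr := comb (x u v) (y u v) (b u v) (l u v)).
  assert (Duu : duE (push z coord_u) u v = fr (- p u v * f) (f * q u v) (f * (f * n)) 0).
  { rewrite (has_partialsE_duE D _ _ _ u v Pu Huv); apply coord_ext; intros c Hc.
    unfold fr; rewrite coord_plus, !coord_scal, !coord_comb by auto.
    unfold times; fold f n; ring. }
  assert (Dvu : dvE (push z coord_u) u v = fr (- q u v * f) (- (f * p u v))
    (f * (f * lam u v)) (f * (f * mu u v))).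
  { rewrite (has_partialsE_dvE D _ _ _ u v Pu Huv); apply coord_ext; intros c Hc.
    unfold fr; rewrite coord_plus, !coord_scal, !coord_comb by auto.
    unfold times; fold f; ring. }
  assert (Duv : duE (push z coord_v) u v = fr (- (f * q u v)) (- p u v * f)
    (f * (f * lam u v)) (f * (f * mu u v))).
  { rewrite (has_partialsE_duE D _ _ _ u v Pv Huv); apply coord_ext; intros c Hc.
    unfold fr; rewrite coord_plus, !coord_scal, !coord_comb by auto.
    unfold times; fold f; ring. }
  assert (Dvv : dvE (push z coord_v) u v = fr (f * p u v) (- q u v * f) (f * (f * n)) 0).
  { rewrite (has_partialsE_dvE D _ _ _ u v Pv Huv); apply coord_ext; intros c Hc.
    unfold fr; rewrite coord_plus, !coord_scal, !coord_comb by auto.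
    unfold times; fold f n; ring. }
  assert (Suu : sff z coord_u coord_u u v = scal (f * f * n) (b u v)).
  { unfold sff; rewrite (built_normal_flat _ _ u v _ _ _ _ _ _ _ _ Huv Duu Dvu).
    apply coord_ext; intros c Hc; rewrite coord_plus, !coord_scal by auto.
    unfold coord_u; simpl; ring. }
  assert (Svv : sff z coord_v coord_v u v = scal (f * f * n) (b u v)).
  { unfold sff; rewrite (built_normal_flat _ _ u v _ _ _ _ _ _ _ _ Huv Duv Dvv).
    apply coord_ext; intros c Hc; rewrite coord_plus, !coord_scal by auto.
    unfold coord_v; simpl; ring. }
  unfold mean_curvature; rewrite Suu, Svv.
  destruct (built_first_form u v Huv) as (-> & -> & ->); fold f.
  assert (Hf : f <> 0) by apply Rgt_not_eq, Hpos.
  apply coord_ext; intros c Hc.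
  rewrite coord_scal, coord_plus, coord_minus, !coord_scal by auto; field; auto.
Qed.

Lemma built_regular : regular_surface D z.
Proof.
  split; [exact Hz|]; intros u v Huv s t E.
  destruct (Hon u v Huv) as ((Hxx & Hyy & _ & _) & Hxy & _).
  rewrite built_duE, built_dvE in E by auto.
  specialize (Hpos u v).
  pose proof (f_equal (fun e => dot e (x u v)) E) as Ex.
  pose proof (f_equal (fun e => dot e (y u v)) E) as Ey.
  cbv beta in Ex, Ey.
  rewrite dot_plus_l, !dot_scal_l, dot_zero_l in Ex, Ey.
  rewrite (dot_sym (y u v) (x u v)), Hxx, Hxy in Ex; rewrite Hxy, Hyy in Ey.
  split; apply (Rmult_eq_reg_r (phi u v)); lra.
Qed.

Lemma built_parallel : parallel_normalized_mean_curvature D z.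
Proof.
  pose proof Hfr as (_ & _ & Fb & _ & _).
  split.
  - intros u v Huv E.
    destruct (Hon u v Huv) as ((_ & _ & Hbb & _) & _).
    rewrite built_mean_curvature in E by auto.
    pose proof (f_equal (fun e => dot e (b u v)) E) as E'; cbv beta in E'.
    rewrite dot_scal_l, dot_zero_l, Hbb in E'.
    specialize (Hnu0 u v Huv); lra.
  - exists b; split; [exact Hb|]; intros u v Huv.
    destruct (Hon u v Huv) as ((_ & _ & Hbb & _) & _ & Hxb & _ & Hyb & _).
    split; [|split].
    + split; [exact Hbb|]; split.
      * rewrite built_duE, dot_sym, dot_scal_l, Hxb by auto; ring.
      * rewrite built_dvE, dot_sym, dot_scal_l, Hyb by auto; ring.
    + exists (nu u v); now apply built_mean_curvature.
    + intros X; unfold normal_connection.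
      rewrite (built_normal_flat X b u v _ _ _ _ _ _ _ _ Huv
        (has_partialsE_duE D _ _ _ u v Fb Huv) (has_partialsE_dvE D _ _ _ u v Fb Huv)).
      apply coord_ext; intros c Hc.
      rewrite coord_plus, !coord_scal, coord_zero by auto; ring.
Qed.

Lemma built_geometric_frame : geometric_frame D z b l nu nu lam mu.
Proof.
  pose proof Hfr as (Fx & Fy & _ & _ & _).
  split; [exact Hb|]; split; [exact Hl|]; intros u v Huv; cbv zeta.
  assert (Px := has_partialsE_ext D _ _ _ (push z (frame_x z)) _ _ HO
    (fun u v H => eq_sym (built_push_x u v H)) (fun u v _ => eq_refl)
    (fun u v _ => eq_refl) Fx).
  assert (Py := has_partialsE_ext D _ _ _ (push z (frame_y z)) _ _ HO
    (fun u v H => eq_sym (built_push_y u v H)) (fun u v _ => eq_refl)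
    (fun u v _ => eq_refl) Fy).
  assert (Hf : phi u v <> 0) by apply Rgt_not_eq, Hpos.
  assert (Value : forall X a1 a2 w c1' c2' c3' c4' d1 d2 d3 d4,
    X u v = (a1, a2) ->
    duE w u v = comb (x u v) (y u v) (b u v) (l u v) c1' c2' c3' c4' ->
    dvE w u v = comb (x u v) (y u v) (b u v) (l u v) d1 d2 d3 d4 ->
    normal z u v (flat X w u v)
    = plus (scal (a1 * c3' + a2 * d3) (b u v)) (scal (a1 * c4' + a2 * d4) (l u v))).
  { intros X a1 a2 w c1' c2' c3' c4' d1 d2 d3 d4 HX E1 E2.
    rewrite (built_normal_flat X w u v _ _ _ _ _ _ _ _ Huv E1 E2), HX; reflexivity. }
  assert (X1 : frame_x z u v = (/ phi u v, 0))
    by (unfold frame_x; now rewrite (proj1 (built_sqrtE u v Huv))).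
  assert (Y1 : frame_y z u v = (0, / phi u v))
    by (unfold frame_y; now rewrite (proj2 (built_sqrtE u v Huv))).
  pose proof (has_partialsE_duE D _ _ _ u v Px Huv) as Xu.
  pose proof (has_partialsE_dvE D _ _ _ u v Px Huv) as Xv.
  pose proof (has_partialsE_duE D _ _ _ u v Py Huv) as Yu.
  pose proof (has_partialsE_dvE D _ _ _ u v Py Huv) as Yv.
  split; [rewrite built_push_x, built_push_y by auto; auto|].
  split; [exists (nu u v); now apply built_mean_curvature|].
  unfold sff; split; [|split].
  - rewrite (Value _ _ _ _ _ _ _ _ _ _ _ _ X1 Xu Xv).
    apply coord_ext; intros c Hc; rewrite coord_plus, !coord_scal by auto.
    unfold times; field; auto.
  - rewrite (Value _ _ _ _ _ _ _ _ _ _ _ _ X1 Yu Yv).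
    apply coord_ext; intros c Hc; rewrite !coord_plus, !coord_scal by auto.
    unfold times; field; auto.
  - rewrite (Value _ _ _ _ _ _ _ _ _ _ _ _ Y1 Yu Yv).
    apply coord_ext; intros c Hc; rewrite coord_plus, !coord_scal by auto.
    unfold times; field; auto.
Qed.

Lemma built_canonical : canonical_parameters D z mu.
Proof.
  intros u v Huv; rewrite <- Hsqr by auto; now apply built_first_form.
Qed.

Theorem frame_equations_surface :
  regular_surface D z /\ parallel_normalized_mean_curvature D z /\
  geometric_frame D z b l nu nu lam mu /\ canonical_parameters D z mu /\
  forall u v, D (u, v) ->
    push z (frame_x z) u v = x u v /\ push z (frame_y z) u v = y u v.
Proof.
  split; [exact built_regular|]; split; [exact built_parallel|].
  split; [exact built_geometric_frame|]; split; [exact built_canonical|].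
  intros u v Huv; split; [now apply built_push_x|now apply built_push_y].
Qed.

End FrameToSurface.

(** * From the surface to the frame equations *)

Section SurfaceToFrame.
Variables (D : R * R -> Prop) (lam mu nu p q phi : R -> R -> R).
Variables (b l z : R -> R -> E4).
Hypothesis HO : open D.
Hypothesis Sphi : smooth D phi.
Hypothesis Hphi : has_partials D phi (fun u v => - p u v * phi u v)
                                     (fun u v => - q u v * phi u v).
Hypothesis Hpos : forall u v, 0 < phi u v.
Hypothesis Hsqr : forall u v, D (u, v) -> phi u v * phi u v = 1 / Rabs (mu u v).
Hypothesis Hz : smoothE D z.
Hypothesis Hpar : parallel_normalized_mean_curvature D z.
Hypothesis Hgf : geometric_frame D z b l nu nu lam mu.
Hypothesis Hcan : canonical_parameters D z mu.

Let x := push z (frame_x z).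
Let y := push z (frame_y z).

Lemma given_frame_vectors u v : D (u, v) ->
  frame_x z u v = (/ phi u v, 0) /\ frame_y z u v = (0, / phi u v).
Proof.
  intros Huv; destruct (Hcan u v Huv) as (E1 & E2 & _).
  unfold frame_x, frame_y; rewrite E1, E2, <- Hsqr by auto.
  specialize (Hpos u v); rewrite sqrt_square by lra; auto.
Qed.

Lemma given_x u v : D (u, v) -> x u v = scal (/ phi u v) (duE z u v).
Proof.
  intros Huv; unfold x, push; rewrite (proj1 (given_frame_vectors u v Huv)).
  apply coord_ext; intros c Hc; simpl.
  rewrite coord_plus, !coord_scal by auto; ring.
Qed.

Lemma given_y u v : D (u, v) -> y u v = scal (/ phi u v) (dvE z u v).
Proof.
  intros Huv; unfold y, push; rewrite (proj2 (given_frame_vectors u v Huv)).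
  apply coord_ext; intros c Hc; simpl.
  rewrite coord_plus, !coord_scal by auto; ring.
Qed.

Lemma given_duE u v : D (u, v) -> duE z u v = scal (phi u v) (x u v).
Proof.
  intros Huv; rewrite given_x by auto; apply coord_ext; intros c Hc.
  rewrite !coord_scal by auto; field; apply Rgt_not_eq, Hpos.
Qed.

Lemma given_dvE u v : D (u, v) -> dvE z u v = scal (phi u v) (y u v).
Proof.
  intros Huv; rewrite given_y by auto; apply coord_ext; intros c Hc.
  rewrite !coord_scal by auto; field; apply Rgt_not_eq, Hpos.
Qed.

Lemma given_smooth_xy : smoothE D x /\ smoothE D y.
Proof.
  assert (Si : smooth D (fun u v => / phi u v)).
  { apply smooth_inv; auto; intros; apply Rgt_not_eq, Hpos. }
  split.
  - apply (smoothE_ext D (fun u v => scal (/ phi u v) (duE z u v))); auto.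
    + intros; symmetry; now apply given_x.
    + apply smoothE_scal; auto using smoothE_duE.
  - apply (smoothE_ext D (fun u v => scal (/ phi u v) (dvE z u v))); auto.
    + intros; symmetry; now apply given_y.
    + apply smoothE_scal; auto using smoothE_dvE.
Qed.

(** [z_uv = z_vu], after division by [phi]. *)
Lemma given_torsion_free u v : D (u, v) ->
  minus (dvE x u v) (scal (q u v) (x u v)) = minus (duE y u v) (scal (p u v) (y u v)).
Proof.
  intros Huv; destruct given_smooth_xy as [Sx Sy].
  assert (Pu := has_partialsE_ext D _ _ _ _ _ _ HO
    (fun u v H => eq_sym (given_duE u v H)) (fun u v _ => eq_refl)
    (fun u v _ => eq_refl)
    (has_partialsE_scal D _ _ _ _ _ _ Hphi (smoothE_partials D x Sx))).
  assert (Pv := has_partialsE_ext D _ _ _ _ _ _ HO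
    (fun u v H => eq_sym (given_dvE u v H)) (fun u v _ => eq_refl)
    (fun u v _ => eq_refl)
    (has_partialsE_scal D _ _ _ _ _ _ Hphi (smoothE_partials D y Sy))).
  apply coord_ext; intros c Hc.
  assert (Schw : c (dvE (duE z) u v) = c (duE (dvE z) u v)).
  { each_coord Hc; apply (smooth_schwarz D HO); auto; apply Hz. }
  rewrite (has_partialsE_dvE D _ _ _ u v Pu Huv),
    (has_partialsE_duE D _ _ _ u v Pv Huv), !coord_plus, !coord_scal in Schw by auto.
  rewrite !coord_minus, !coord_scal by auto.
  apply (Rmult_eq_reg_l (phi u v)); [lra|apply Rgt_not_eq, Hpos].
Qed.

Lemma given_orthonormal u v : D (u, v) -> orthonormal (x u v) (y u v) (b u v) (l u v).
Proof. intros Huv; now apply Hgf. Qed.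

Lemma dot_flat_normal X w n u v : D (u, v) -> dot (x u v) n = 0 -> dot (y u v) n = 0 ->
  dot (normal z u v (flat X w u v)) n
  = fst (X u v) * dot (duE w u v) n + snd (X u v) * dot (dvE w u v) n.
Proof.
  intros Huv H1 H2; rewrite dot_normal.
  - unfold flat; rewrite dot_plus_l, !dot_scal_l; reflexivity.
  - rewrite given_duE, dot_sym, dot_scal_l, H1 by auto; ring.
  - rewrite given_dvE, dot_sym, dot_scal_l, H2 by auto; ring.
Qed.

(** The given unit normal [b] differs from the parallel one by a sign, and a
    smooth function with values [1] and [-1] has zero derivative. *)
Lemma given_b_parallel u v : D (u, v) ->
  dot (duE b u v) (l u v) = 0 /\ dot (dvE b u v) (l u v) = 0.
Proof.
  intros Huv; destruct Hpar as [HH [b' [Sb' Hb']]].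
  pose proof Hgf as (Sb & Sl & _).
  set (s := fun u v => dot (b u v) (b' u v)).
  assert (Key : forall u v, D (u, v) ->
    b u v = scal (s u v) (b' u v) /\ s u v * s u v = 1).
  { intros u' v' H'; destruct (Hb' u' v' H') as ((N' & _) & [k' E'] & _).
    destruct Hgf as (_ & _ & G); destruct (G u' v' H') as (ON & [k E] & _).
    destruct ON as ((_ & _ & N & _) & _).
    assert (Hk : k <> 0).
    { intros ->; apply (HH u' v' H'); rewrite E; apply coord_ext; intros c Hc.
      rewrite coord_scal, coord_zero by auto; ring. }
    assert (Eb : b u' v' = scal (k' / k) (b' u' v')).
    { apply coord_ext; intros c Hc; rewrite coord_scal by auto.
      rewrite E in E'; apply (f_equal c) in E'; rewrite !coord_scal in E' by auto.
      apply (Rmult_eq_reg_l k); auto; rewrite E'; field; auto. }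
    assert (Es : s u' v' = k' / k)
      by (unfold s; rewrite Eb, dot_scal_l, N'; ring).
    rewrite Es; split; auto.
    rewrite Eb, dot_scal_l, dot_sym, dot_scal_l, N' in N; lra. }
  assert (Ss : smooth D s) by (apply smooth_dot; auto).
  pose proof (smooth_partials D s Ss) as Ps.
  assert (Zero : du s u v = 0 /\ dv s u v = 0).
  { pose proof (has_partials_ext D _ (fun _ _ : R => 1) _ _ _ _ HO
      (fun u v H => proj2 (Key u v H)) (fun u v _ => eq_refl) (fun u v _ => eq_refl)
      (has_partials_mult D _ _ _ _ _ _ Ps Ps)) as P2.
    pose proof (has_partials_const D 1) as Pc.
    pose proof (has_partials_du D _ _ _ u v P2 Huv) as U2.
    pose proof (has_partials_dv D _ _ _ u v P2 Huv) as V2.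
    rewrite (has_partials_du D _ _ _ u v Pc Huv) in U2.
    rewrite (has_partials_dv D _ _ _ u v Pc Huv) in V2.
    destruct (Key u v Huv) as [_ K].
    assert (Hs0 : s u v <> 0) by (intros H0; rewrite H0 in K; lra).
    split; apply (Rmult_eq_reg_l (s u v)); auto; lra. }
  pose proof (has_partialsE_ext D _ _ _ b _ _ HO
    (fun u v H => eq_sym (proj1 (Key u v H))) (fun u v _ => eq_refl)
    (fun u v _ => eq_refl)
    (has_partialsE_scal D _ _ _ _ _ _ Ps (smoothE_partials D b' Sb'))) as Pb.
  destruct (given_orthonormal u v Huv) as (_ & _ & _ & Hxl & _ & Hyl & _).
  destruct (Hb' u v Huv) as (_ & _ & Hpar').
  pose proof (f_equal (fun e => dot e (l u v)) (Hpar' coord_u)) as D1.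
  pose proof (f_equal (fun e => dot e (l u v)) (Hpar' coord_v)) as D2.
  cbv beta in D1, D2; unfold normal_connection in D1, D2.
  rewrite dot_flat_normal, dot_zero_l in D1, D2 by auto; simpl in D1, D2.
  rewrite (has_partialsE_duE D _ _ _ u v Pb Huv), (has_partialsE_dvE D _ _ _ u v Pb Huv).
  rewrite !dot_plus_l, !dot_scal_l, (proj1 Zero), (proj2 Zero).
  replace (dot (duE b' u v) (l u v)) with 0 by lra.
  replace (dot (dvE b' u v) (l u v)) with 0 by lra.
  split; ring.
Qed.

(** The derivatives of an orthonormal frame are skew, so six scalar products in
    each direction determine them; all twelve are read off from the second
    fundamental form, the absence of torsion and [Db = 0]. *)
Lemma given_frame_equations :
  frame_equations D p q phi (times phi nu) (times phi lam) (times phi mu) x y b l z.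
Proof.
  destruct given_smooth_xy as [Sx Sy].
  pose proof Hgf as (Sb & Sl & G).
  assert (Main : forall u v, D (u, v) ->
    let fr := comb (x u v) (y u v) (b u v) (l u v) in
    let al := phi u v * nu u v in let be := phi u v * lam u v in
    let ga := phi u v * mu u v in let p := p u v in let q := q u v in
    (duE x u v = fr 0 q al 0 /\ dvE x u v = fr 0 (- p) be ga) /\
    (duE y u v = fr (- q) 0 be ga /\ dvE y u v = fr p 0 al 0) /\
    (duE b u v = fr (- al) (- be) 0 0 /\ dvE b u v = fr (- be) (- al) 0 0) /\
    (duE l u v = fr 0 (- ga) 0 0 /\ dvE l u v = fr (- ga) 0 0 0)).
  { intros u v Huv; cbv zeta.
    pose proof (given_orthonormal u v Huv) as ON.
    assert (Cst : forall a c k, smoothE D a -> smoothE D c ->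
      (forall u v, orthonormal (x u v) (y u v) (b u v) (l u v) ->
         dot (a u v) (c u v) = k) ->
      dot (duE a u v) (c u v) + dot (duE c u v) (a u v) = 0 /\
      dot (dvE a u v) (c u v) + dot (dvE c u v) (a u v) = 0).
    { intros a c k Sa Sc Hk; apply (dot_constant D a c k); auto.
      intros s t Hst; apply Hk, given_orthonormal, Hst. }
    destruct (Cst x x 1 Sx Sx) as [Xxu Xxv]; [unfold orthonormal; tauto|].
    destruct (Cst y y 1 Sy Sy) as [Yyu Yyv]; [unfold orthonormal; tauto|].
    destruct (Cst b b 1 Sb Sb) as [Bbu Bbv]; [unfold orthonormal; tauto|].
    destruct (Cst l l 1 Sl Sl) as [Llu Llv]; [unfold orthonormal; tauto|].
    destruct (Cst x y 0 Sx Sy) as [Xyu Xyv]; [unfold orthonormal; tauto|].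
    destruct (Cst x b 0 Sx Sb) as [Xbu Xbv]; [unfold orthonormal; tauto|].
    destruct (Cst x l 0 Sx Sl) as [Xlu Xlv]; [unfold orthonormal; tauto|].
    destruct (Cst y b 0 Sy Sb) as [Ybu Ybv]; [unfold orthonormal; tauto|].
    destruct (Cst y l 0 Sy Sl) as [Ylu Ylv]; [unfold orthonormal; tauto|].
    destruct (Cst b l 0 Sb Sl) as [Blu Blv]; [unfold orthonormal; tauto|].
    clear Cst.
    destruct (given_b_parallel u v Huv) as [Pu Pv].
    pose proof (given_torsion_free u v Huv) as T.
    destruct (G u v Huv) as (_ & _ & Gxx & Gxy & Gyy); clear G.
    destruct (given_frame_vectors u v Huv) as [Fx Fy].
    pose proof ON as ((Hxx & Hyy & Hbb & Hll) & Hxy & Hxb & Hxl & Hyb & Hyl & Hbl).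
    pose proof (dot_sym (y u v) (x u v)) as Hyx.
    pose proof (dot_sym (b u v) (x u v)) as Hbx.
    pose proof (dot_sym (l u v) (x u v)) as Hlx.
    pose proof (dot_sym (b u v) (y u v)) as Hby.
    pose proof (dot_sym (l u v) (y u v)) as Hly.
    pose proof (dot_sym (l u v) (b u v)) as Hlb.
    assert (Hf : phi u v <> 0) by apply Rgt_not_eq, Hpos.
    assert (Inv : phi u v * / phi u v = 1) by (field; auto).
    fold x y in Gxx, Gxy, Gyy.
    unfold sff in Gxx, Gxy, Gyy.
    fold x y in Gxx, Gxy, Gyy.
    assert (Along : forall s r k, / phi u v * s + 0 * r = k -> s = phi u v * k).
    { intros s r k <-; field; auto. }
    assert (Along' : forall s r k, 0 * r + / phi u v * s = k -> s = phi u v * k).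
    { intros s r k <-; field; auto. }
    assert (Dxb : dot (duE x u v) (b u v) = phi u v * nu u v).
    { apply (f_equal (fun e => dot e (b u v))) in Gxx; cbv beta in Gxx.
      rewrite dot_flat_normal, Fx, dot_scal_l, Hbb, Rmult_1_r in Gxx by auto.
      eapply Along, Gxx. }
    assert (Dxl : dot (duE x u v) (l u v) = 0).
    { apply (f_equal (fun e => dot e (l u v))) in Gxx; cbv beta in Gxx.
      rewrite dot_flat_normal, Fx, dot_scal_l, Hbl in Gxx by auto.
      apply Along in Gxx; lra. }
    assert (Dyb : dot (duE y u v) (b u v) = phi u v * lam u v).
    { apply (f_equal (fun e => dot e (b u v))) in Gxy; cbv beta in Gxy.
      rewrite dot_flat_normal, Fx, dot_plus_l, !dot_scal_l, Hbb, Hlb, Hbl in Gxy by auto.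
      apply Along in Gxy; lra. }
    assert (Dyl : dot (duE y u v) (l u v) = phi u v * mu u v).
    { apply (f_equal (fun e => dot e (l u v))) in Gxy; cbv beta in Gxy.
      rewrite dot_flat_normal, Fx, dot_plus_l, !dot_scal_l, Hll, Hbl in Gxy by auto.
      apply Along in Gxy; lra. }
    assert (Dyb' : dot (dvE y u v) (b u v) = phi u v * nu u v).
    { apply (f_equal (fun e => dot e (b u v))) in Gyy; cbv beta in Gyy.
      rewrite dot_flat_normal, Fy, dot_scal_l, Hbb, Rmult_1_r in Gyy by auto.
      eapply Along', Gyy. }
    assert (Dyl' : dot (dvE y u v) (l u v) = 0).
    { apply (f_equal (fun e => dot e (l u v))) in Gyy; cbv beta in Gyy.
      rewrite dot_flat_normal, Fy, dot_scal_l, Hbl in Gyy by auto.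
      apply Along' in Gyy; lra. }
    (* Only [x_u], [y_u] and [y_v] occur in the second fundamental form; the
       absence of torsion transfers the information to [x_v] and supplies the
       connection coefficients [p], [q]. *)
    assert (T' : forall e, dot (dvE x u v) e - q u v * dot (x u v) e
      = dot (duE y u v) e - p u v * dot (y u v) e).
    { intros e; apply (f_equal (fun d => dot d e)) in T; cbv beta in T.
      now rewrite !dot_minus_l, !dot_scal_l in T. }
    pose proof (T' (x u v)) as Tx; pose proof (T' (y u v)) as Ty.
    pose proof (T' (b u v)) as Tb; pose proof (T' (l u v)) as Tl.
    rewrite Hxx, Hyx, Hxy in Tx; rewrite Hxy, Hyy in Ty.
    rewrite Hxb, Hyb in Tb; rewrite Hxl, Hyl in Tl.
    clear T T' Gxx Gxy Gyy Along Along'.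
    repeat split;
      (etransitivity; [apply (orthonormal_expand _ _ _ _ _ ON)|]);
      f_equal; lra. }
  assert (Fin : forall w P Q, smoothE D w ->
    (forall u v, D (u, v) -> duE w u v = P u v /\ dvE w u v = Q u v) ->
    has_partialsE D w P Q).
  { intros w P Q Sw H.
    eapply (has_partialsE_ext D w (duE w) (dvE w)); auto using smoothE_partials;
      intros; now apply H. }
  refine (conj _ (conj _ (conj _ (conj _ _)))); apply Fin; auto; intros u v Huv;
    try apply (Main u v Huv).
  rewrite given_duE, given_dvE by auto.
  split; apply coord_ext; intros c Hc; rewrite coord_scal, coord_comb by auto; ring.
Qed.

End SurfaceToFrame.

(** * Squares in the plane *)

(** Along a segment of the square joining the two open sets, a point common to
    both is found near the supremum of the parameters sent into the first. *)
Lemma connected_box u0 v0 r : connected_set (box u0 v0 r).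
Proof.
  intros A B HA HB Hcov [[p1 p2] [Hp HpA]] [[q1 q2] [Hq HqB]].
  set (g := fun t : R => (p1 + t * (q1 - p1), p2 + t * (q2 - p2))).
  assert (Conv : forall a x y t, Rabs (x - a) < r -> Rabs (y - a) < r ->
    0 <= t <= 1 -> Rabs (x + t * (y - x) - a) < r).
  { intros a x y t Hx Hy Ht.
    apply Rabs_def2 in Hx; apply Rabs_def2 in Hy.
    assert (0 <= t * Rabs (y - x) <= Rabs (y - x))
      by (pose proof (Rabs_pos (y - x)); nra).
    apply Rabs_def1; unfold Rabs in *; destruct (Rcase_abs (y - x)); lra. }
  assert (Gbox : forall t, 0 <= t <= 1 -> box u0 v0 r (g t)).
  { intros t Ht; destruct Hp as [P1 P2], Hq as [Q1 Q2]; split; simpl in *;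
      apply Conv; auto. }
  set (K := Rabs (q1 - p1) + Rabs (q2 - p2) + 1).
  pose proof (Rabs_pos (q1 - p1)); pose proof (Rabs_pos (q2 - p2)).
  assert (Near : forall S : R * R -> Prop, open S -> forall m, S (g m) ->
    exists e, 0 < e /\ forall t, Rabs (t - m) < e -> S (g t)).
  { intros S HS m Hm; destruct (open_locally_2d S _ _ HS Hm) as [d Hd].
    pose proof (cond_pos d).
    exists (d / K); split; [apply Rdiv_lt_0_compat; unfold K; lra|].
    intros t Ht.
    assert (HtK : Rabs (t - m) * K < d).
    { apply (Rmult_lt_compat_r K) in Ht; [|unfold K; lra].
      replace (d / K * K) with (pos d) in Ht by (field; unfold K; lra); exact Ht. }
    pose proof (Rabs_pos (t - m)).
    assert (0 <= Rabs (t - m) * Rabs (q1 - p1)) by (apply Rmult_le_pos; auto).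
    assert (0 <= Rabs (t - m) * Rabs (q2 - p2)) by (apply Rmult_le_pos; auto).
    unfold K in HtK; apply Hd.
    - replace (p1 + t * (q1 - p1) - (p1 + m * (q1 - p1))) with ((t - m) * (q1 - p1)) by ring.
      rewrite Rabs_mult; lra.
    - replace (p2 + t * (q2 - p2) - (p2 + m * (q2 - p2))) with ((t - m) * (q2 - p2)) by ring.
      rewrite Rabs_mult; lra. }
  assert (G0 : A (g 0)).
  { unfold g; replace (p1 + 0 * (q1 - p1)) with p1 by ring.
    now replace (p2 + 0 * (q2 - p2)) with p2 by ring. }
  assert (G1 : B (g 1)).
  { unfold g; replace (p1 + 1 * (q1 - p1)) with q1 by ring.
    now replace (p2 + 1 * (q2 - p2)) with q2 by ring. }
  set (E := fun t => 0 <= t <= 1 /\ A (g t)).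
  destruct (completeness E) as [m [Hub Hlub]].
  { exists 1; intros t [Ht _]; lra. }
  { exists 0; split; [lra|auto]. }
  assert (Hm0 : 0 <= m) by (apply Hub; split; [lra|auto]).
  assert (Hm1 : m <= 1) by (apply Hlub; intros t [Ht _]; lra).
  destruct (Hcov (g m) (Gbox m (conj Hm0 Hm1))) as [Ha|Hb].
  - destruct (Req_dec m 1) as [->|Hne]; [exists (g 1); split; auto|].
    destruct (Near A HA m Ha) as [e [He HeA]].
    set (t := Rmin 1 (m + e / 2)).
    assert (Ht : m < t) by (apply Rmin_glb_lt; lra).
    assert (t <= 1) by apply Rmin_l.
    assert (t <= m + e / 2) by apply Rmin_r.
    assert (t <= m); [|lra].
    apply Hub; split; [lra|]; apply HeA; rewrite Rabs_right; lra.
  - destruct (Near B HB m Hb) as [e [He HeB]].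
    destruct (classic (exists t, E t /\ m - e < t)) as [[t [[Ht HtA] Hte]]|Hno].
    + exists (g t); split; [auto|]; split; [auto|]; apply HeB.
      assert (t <= m) by (apply Hub; split; auto).
      rewrite Rabs_left1; lra.
    + assert (m <= m - e); [|lra].
      apply Hlub; intros t Ht; apply Rnot_lt_le; intros Hlt; apply Hno; exists t; auto.
Qed.

Lemma box_center u0 v0 r : 0 < r -> box u0 v0 r (u0, v0).
Proof. intros Hr; split; simpl; rewrite Rminus_diag, Rabs_R0; auto. Qed.

Lemma planar_domain_box u0 v0 r : 0 < r -> planar_domain (box u0 v0 r).
Proof.
  intros Hr; split; [exists (u0, v0); now apply box_center|].
  split; [apply open_box|apply connected_box].
Qed.

Lemma box_constant f u0 v0 r u v :
  has_partials (box u0 v0 r) f (fun _ _ => 0) (fun _ _ => 0) ->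
  box u0 v0 r (u, v) -> f u v = f u0 v0.
Proof.
  intros Hf [Hu Hv]; simpl in Hu, Hv.
  assert (Hr : 0 < r) by (pose proof (Rabs_pos (u - u0)); lra).
  assert (V : Rabs (f u v - f u v0) <= 0 * Rabs (v - v0)).
  { apply (bounded_variation (fun t => f u t) (fun _ => 0)); intros t Ht.
    split; [apply (Hf u t); split; simpl; lra|rewrite Rabs_R0; lra]. }
  assert (U : Rabs (f u v0 - f u0 v0) <= 0 * Rabs (u - u0)).
  { apply (bounded_variation (fun s => f s v0) (fun _ => 0)); intros s Hs.
    split; [apply (Hf s v0); split; simpl; [lra|]|rewrite Rabs_R0; lra].
    rewrite Rminus_diag, Rabs_R0; auto. }
  rewrite Rmult_0_l in V, U.
  apply Rabs_le_between in V; apply Rabs_le_between in U; lra.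
Qed.

(** With frame matrix [M] having rows [x, y, b, l], skewness of the derivation
    matrices makes [M^T M] constant, with no differential equation left to
    solve; transposing twice returns to [M M^T = I]. *)
Lemma frame_stays_orthonormal u0 v0 r p q f al be ga x y b l z u v :
  frame_equations (box u0 v0 r) p q f al be ga x y b l z ->
  orthonormal (x u0 v0) (y u0 v0) (b u0 v0) (l u0 v0) ->
  box u0 v0 r (u, v) -> orthonormal (x u v) (y u v) (b u v) (l u v).
Proof.
  intros (Fx & Fy & Fb & Fl & _) H0 Huv.
  set (T := fun (c : E4 -> R) s t => (c (x s t), c (y s t), c (b s t), c (l s t)) : E4).
  assert (Const : forall c d, coord c -> coord d ->
    dot (T c u v) (T d u v) = dot (T c u0 v0) (T d u0 v0)).
  { intros c d Hc Hd.
    apply (box_constant (fun s t => dot (T c s t) (T d s t)) u0 v0 r); auto.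
    assert (Prod : forall w P Q, has_partialsE (box u0 v0 r) w P Q ->
      has_partials (box u0 v0 r) (fun s t => c (w s t) * d (w s t)) _ _)
      by (intros w P Q Hw; exact (has_partials_mult _ _ _ _ _ _ _ (Hw c Hc) (Hw d Hd))).
    pose proof (has_partials_plus _ _ _ _ _ _ _ (has_partials_plus _ _ _ _ _ _ _
      (has_partials_plus _ _ _ _ _ _ _ (Prod _ _ _ Fx) (Prod _ _ _ Fy))
      (Prod _ _ _ Fb)) (Prod _ _ _ Fl)) as H.
    eapply has_partials_ext; [apply open_box| | | |exact H]; simpl.
    - reflexivity.
    - intros; rewrite !coord_comb by auto; ring.
    - intros; rewrite !coord_comb by auto; ring. }
  apply orthonormal_transpose in H0.
  change (orthonormal (T c1 u0 v0) (T c2 u0 v0) (T c3 u0 v0) (T c4 u0 v0)) in H0.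
  assert (H : orthonormal (T c1 u v) (T c2 u v) (T c3 u v) (T c4 u v)).
  { unfold orthonormal in H0 |- *.
    rewrite !Const by (unfold coord; auto); exact H0. }
  apply orthonormal_transpose in H.
  assert (Eta : forall w : E4, (c1 w, c2 w, c3 w, c4 w) = w)
    by (intros [[[w1 w2] w3] w4]; reflexivity).
  unfold T in H; rewrite <- (Eta (x u v)), <- (Eta (y u v)), <- (Eta (b u v)),
    <- (Eta (l u v)); exact H.
Qed.

Theorem theorem3p4 (D : R * R -> Prop) (lam mu nu : R -> R -> R)
    (hD : planar_domain D)
    (hlam : smooth D lam) (hmu : smooth D mu) (hnu : smooth D nu)
    (hmu0 : forall u v, D (u, v) -> mu u v <> 0)
    (hnuc : ~ exists c : R, forall u v, D (u, v) -> nu u v = c)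
    (hnu_u : forall u v, D (u, v) ->
       du nu u v = dv lam u v - lam u v * dv (ln_abs mu) u v)
    (hnu_v : forall u v, D (u, v) ->
       dv nu u v = du lam u v - lam u v * du (ln_abs mu) u v)
    (hgauss : forall u v, D (u, v) ->
       nu u v ^ 2 - (lam u v ^ 2 + mu u v ^ 2)
         = 1 / 2 * Rabs (mu u v) * laplacian (ln_abs mu) u v)
    (u0 v0 : R) (h0 : D (u0, v0)) (hnu0 : nu u0 v0 <> 0)
    (p0 x0 y0 b0 l0 : E4) (hframe : orthonormal x0 y0 b0 l0) :
  exists D0 : R * R -> Prop,
    planar_domain D0 /\ (forall p, D0 p -> D p) /\ D0 (u0, v0) /\
    (exists z : R -> R -> E4,
      prescribed_surface D0 lam mu nu u0 v0 p0 x0 y0 b0 l0 z) /\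
    (forall z1 z2 : R -> R -> E4,
      prescribed_surface D0 lam mu nu u0 v0 p0 x0 y0 b0 l0 z1 ->
      prescribed_surface D0 lam mu nu u0 v0 p0 x0 y0 b0 l0 z2 ->
      forall u v, D0 (u, v) -> z1 u v = z2 u v).
Proof.
  destruct hD as (_ & HO & _).
  (* On a square where [nu] does not vanish, [H = nu b] does not vanish either. *)
  pose proof (locally_2d_and _ _ u0 v0 (open_locally_2d D u0 v0 HO h0)
    (continuity_2d_pt_neq_0 nu u0 v0 (smooth_continuity D nu u0 v0 hnu h0) hnu0))
    as [d Hd].
  assert (Hd' : forall u v, box u0 v0 d (u, v) -> D (u, v) /\ nu u v <> 0)
    by (intros u v [Hu Hv]; apply Hd; auto).
  set (w := ln_abs mu) in *.
  set (phi := conformal mu); set (p := half_du w); set (q := half_dv w).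
  destruct (pfaff_solvable 4
    (frame_mx_u p q phi (times phi nu) (times phi lam) (times phi mu))
    (frame_mx_v p q phi (times phi nu) (times phi lam) (times phi mu))
    (box u0 v0 d) u0 v0) as (r & Hr & Hsub & Hex & Huniq).
  { apply open_box. }
  { apply box_center, cond_pos. }
  { assert (Hs : forall f, smooth D f -> smooth (box u0 v0 d) f).
    { intros f; apply smooth_subset; intros [u v] H; now apply Hd'. }
    intros i j _ _; apply (frame_mx_smooth (box u0 v0 d)); auto using open_box.
    intros u v H; apply hmu0, Hd', H. }
  { intros i j u v Hi Hj H; apply (frame_mx_integrable D); auto; now apply Hd'. }
  set (D0 := box u0 v0 r) in *.
  assert (H0D : forall u v, D0 (u, v) -> D (u, v)) by (intros; apply Hd', Hsub; auto).
  assert (HO0 : open D0) by apply open_box.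
  assert (Hsm : forall f, smooth D f -> smooth D0 f).
  { intros f; apply smooth_subset; intros [u v]; auto. }
  assert (Hmu0' : forall u v, D0 (u, v) -> mu u v <> 0) by auto.
  assert (Pf : has_partials D0 phi (fun u v => - p u v * phi u v)
                                   (fun u v => - q u v * phi u v))
    by (apply conformal_partials; auto).
  assert (Ppos : forall u v, 0 < phi u v) by (intros; apply conformal_pos).
  assert (Psqr : forall u v, D0 (u, v) -> phi u v * phi u v = 1 / Rabs (mu u v))
    by (intros; apply (conformal_sqr D0); auto).
  assert (Psm : smooth D0 phi) by (apply smooth_conformal; auto).
  exists D0; split; [now apply planar_domain_box|].
  split; [intros [u v]; auto|]; split; [now apply box_center|]; split.
  - set (init := fun (c : E4 -> R) (i : nat) => c (match i with
      | 0%nat => x0 | 1%nat => y0 | 2%nat => b0 | 3%nat => l0 | _ => p0 end)).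
    destruct (Hex (init c1)) as (Y1 & I1 & S1 & F1).
    destruct (Hex (init c2)) as (Y2 & I2 & S2 & F2).
    destruct (Hex (init c3)) as (Y3 & I3 & S3 & F3).
    destruct (Hex (init c4)) as (Y4 & I4 & S4 & F4).
    (* The system acts on each coordinate separately, so the four scalar solutions
       assemble into vector fields. *)
    set (V := fun i u v => (Y1 i u v, Y2 i u v, Y3 i u v, Y4 i u v) : E4).
    assert (SV : forall i, (i <= 4)%nat -> smoothE D0 (V i))
      by (intros i Hi; exact (conj (S1 i Hi) (conj (S2 i Hi) (conj (S3 i Hi) (S4 i Hi))))).
    assert (Fr : frame_equations D0 p q phi (times phi nu) (times phi lam)
      (times phi mu) (V 0%nat) (V 1%nat) (V 2%nat) (V 3%nat) (V 4%nat)).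
    { apply frame_equations_pfaff; auto; intros c Hc.
      assert (G : forall Y, (forall i u v, c (V i u v) = Y i u v) ->
        solves_pfaff 4 D0 (frame_mx_u p q phi (times phi nu) (times phi lam) (times phi mu))
          (frame_mx_v p q phi (times phi nu) (times phi lam) (times phi mu)) Y ->
        solves_pfaff 4 D0 (frame_mx_u p q phi (times phi nu) (times phi lam) (times phi mu))
          (frame_mx_v p q phi (times phi nu) (times phi lam) (times phi mu))
          (stack c (V 0%nat) (V 1%nat) (V 2%nat) (V 3%nat) (V 4%nat))).
      { intros Y HY F i Hi.
        assert (E : forall j u v, (j <= 4)%nat -> Y j u v
          = stack c (V 0%nat) (V 1%nat) (V 2%nat) (V 3%nat) (V 4%nat) j u v).
        { intros j u v Hj; rewrite <- HY; index_cases j Hj; reflexivity. }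
        eapply has_partials_ext; [exact HO0| | | |exact (F i Hi)]; simpl; intros u v _.
        - auto.
        - apply row_col_ext; auto.
        - apply row_col_ext; auto. }
      each_coord Hc; [apply (G Y1)|apply (G Y2)|apply (G Y3)|apply (G Y4)]; auto. }
    assert (V0 : forall i, (i <= 4)%nat -> V i u0 v0 = match i with
      | 0%nat => x0 | 1%nat => y0 | 2%nat => b0 | 3%nat => l0 | _ => p0 end).
    { intros i Hi; unfold V; rewrite I1, I2, I3, I4 by auto; unfold init.
      destruct (match i with 0%nat => x0 | 1%nat => y0 | 2%nat => b0 | 3%nat => l0
                | _ => p0 end) as [[[e1 e2] e3] e4]; reflexivity. }
    assert (On : forall u v, D0 (u, v) ->
      orthonormal (V 0%nat u v) (V 1%nat u v) (V 2%nat u v) (V 3%nat u v)).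
    { intros u v; eapply frame_stays_orthonormal; [exact Fr|].
      rewrite !V0 by lia; exact hframe. }
    assert (Nu : forall u v, D0 (u, v) -> nu u v <> 0)
      by (intros; apply Hd', Hsub; auto).
    assert (H00 : D0 (u0, v0)) by now apply box_center.
    destruct (frame_equations_surface D0 lam mu nu p q phi (V 0%nat) (V 1%nat)
      (V 2%nat) (V 3%nat) (V 4%nat) HO0 Pf Ppos Psqr Nu (SV 2%nat ltac:(lia))
      (SV 3%nat ltac:(lia)) (SV 4%nat ltac:(lia)) On Fr) as (C1 & C2 & C3 & C4 & C5).
    destruct (C5 u0 v0 H00) as [Cx Cy].
    exists (V 4%nat); split; [exact C1|]; split; [exact C2|].
    split; [now rewrite V0 by lia|]; split; [|exact C4].
    exists (V 2%nat), (V 3%nat); rewrite Cx, Cy, !V0 by lia; auto.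
  - intros z1 z2 P1 P2 u v Huv.
    destruct P1 as ((R1 & _) & Q1 & Z1 & (b1 & l1 & G1 & X1 & Y1 & B1 & L1) & C1).
    destruct P2 as ((R2 & _) & Q2 & Z2 & (b2 & l2 & G2 & X2 & Y2 & B2 & L2) & C2).
    pose proof (given_frame_equations D0 lam mu nu p q phi b1 l1 z1 HO0 Psm Pf Ppos
      Psqr R1 Q1 G1 C1) as F1.
    pose proof (given_frame_equations D0 lam mu nu p q phi b2 l2 z2 HO0 Psm Pf Ppos
      Psqr R2 Q2 G2 C2) as F2.
    apply coord_ext; intros c Hc.
    rewrite frame_equations_pfaff in F1, F2 by exact HO0.
    assert (HI : forall i, (i <= 4)%nat ->
      stack c (push z1 (frame_x z1)) (push z1 (frame_y z1)) b1 l1 z1 i u0 v0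
      = stack c (push z2 (frame_x z2)) (push z2 (frame_y z2)) b2 l2 z2 i u0 v0)
      by (intros i Hi; unfold stack; index_cases i Hi; congruence).
    exact (Huniq _ _ HI (F1 c Hc) (F2 c Hc) 4%nat u v (Nat.le_refl 4) Huv).
Qed.
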